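(* Let $R$ be a ring, $M$ an $R$-$R$-bimodule, $R\ltimes M$ the trivial ring extension, $n\geqslant 1$ an integer, and $\mathcal{C},\mathcal{D}$ classes of left $R$-modules. (1) Let $(\mathfrak{U}^{\mathcal{C}},\mathfrak{J}^{\mathcal{D}})$ be a hereditary left $n$-cotorsion pair in $R\ltimes M$-$\mathrm{Mod}$. Assume that $\mathrm{Ext}_R^i(M,D)=0$, $\mathrm{Ext}_R^1(\mathrm{Hom}_R(M,D),D)=0$ and $\mathrm{Hom}_R(M,D)\in\mathcal{D}$ for each $1\leqslant i\leqslant n$ and any $D\in\mathcal{D}$, and that $\mathcal{D}_{n-1}^{\wedge}$ is closed under extensions. Then $(\mathcal{C},\mathcal{D})$ is a hereditary left $n$-cotorsion pair in $R$-$\mathrm{Mod}$. (2) Let $(\mathfrak{B}^{\mathcal{C}},\mathfrak{U}^{\mathcal{D}})$ be a hereditary right $n$-cotorsion pair in $R\ltimes M$-$\mathrm{Mod}$. Assume that $\mathrm{Tor}_i^R(M,C)=0$, $\mathrm{Ext}_R^1(C,M\otimes_R C)=0$ and $M\otimes_R C\in\mathcal{C}$ for each $1\leqslant i\leqslant n$ and any $C\in\mathcal{C}$, and that $\mathcal{C}_{n-1}^{\vee}$ is closed under extensions. Then $(\mathcal{C},\mathcal{D})$ is a hereditary right $n$-cotorsion pair in $R$-$\mathrm{Mod}$.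
   Context: Rings are associative with identity, modules are unitary, and $S$-$\mathrm{Mod}$ is the category of left $S$-modules. Classes of modules contain $0$ and are closed under isomorphisms. The trivial ring extension $R\ltimes M$ is $R\times M$ with componentwise addition and $(r_1,m_1)(r_2,m_2)=(r_1r_2,r_1m_2+m_1r_2)$. A left $R\ltimes M$-module is identified with a pair $(X,\alpha)$, where $X$ is a left $R$-module and $\alpha:M\otimes_R X\to X$ is $R$-linear with $\alpha\circ(M\otimes_R\alpha)=0$; equivalently (by adjunction) with a pair $[Y,\beta]$, where $Y$ is a left $R$-module and $\beta:Y\to\mathrm{Hom}_R(M,Y)$ is $R$-linear with $\mathrm{Hom}_R(M,\beta)\circ\beta=0$. Morphisms are $R$-linear maps compatible with the structure maps; a sequence is exact iff the underlying sequence of $R$-modules is exact. For a class $\mathcal{C}$ of left $R$-modules: $\mathfrak{U}^{\mathcal{C}}$ is the class of $R\ltimes M$-modules $(X,\alpha)$ with $X\in\mathcal{C}$ (equivalently $[Y,\beta]$ with $Y\in\mathcal{C}$); $\mathfrak{B}^{\mathcal{C}}$ is the class of $(X,\alpha)$ with $\mathrm{Coker}\,\alpha\in\mathcal{C}$ and $M\otimes_R M\otimes_R X\xrightarrow{M\otimes_R\alpha}M\otimes_R X\xrightarrow{\alpha}X$ exact; $\mathfrak{J}^{\mathcal{C}}$ is the class of $[Y,\beta]$ with $\mathrm{Ker}\,\beta\in\mathcal{C}$ and $Y\xrightarrow{\beta}\mathrm{Hom}_R(M,Y)\xrightarrow{\mathrm{Hom}_R(M,\beta)}\mathrm{Hom}_R(M,\mathrm{Hom}_R(M,Y))$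 exact. For a class $\mathcal{C}$ of objects of an abelian category and $m\geqslant 0$: $\mathcal{C}_m^{\wedge}$ is the class of objects $A$ admitting an exact sequence $0\to C_k\to\cdots\to C_0\to A\to 0$ with all $C_i\in\mathcal{C}$ and some $k\leqslant m$; $\mathcal{C}_m^{\vee}$ is the class of objects $A$ admitting an exact sequence $0\to A\to C^0\to\cdots\to C^k\to 0$ with all $C^i\in\mathcal{C}$ and some $k\leqslant m$. A pair $(\mathcal{C},\mathcal{D})$ of classes of objects in an abelian category is a left $n$-cotorsion pair if (i) $\mathcal{C}$ is closed under direct summands, (ii) $\mathrm{Ext}^i(C,D)=0$ for all $1\leqslant i\leqslant n$, $C\in\mathcal{C}$, $D\in\mathcal{D}$, and (iii) every object $A$ admits a short exact sequence $0\to K\to C\to A\to 0$ with $C\in\mathcal{C}$, $K\in\mathcal{D}_{n-1}^{\wedge}$. It is a right $n$-cotorsion pair if (i') $\mathcal{D}$ is closed under direct summands, (ii) holds, and (iii') every object $A$ admits a short exact sequence $0\to A\to D\to K\to 0$ with $D\in\mathcal{D}$, $K\in\mathcal{C}_{n-1}^{\vee}$. A left or right $n$-cotorsion pair $(\mathcal{C},\mathcal{D})$ is hereditary if $\mathrm{Ext}^{n+1}(C,D)=0$ for all $C\in\mathcal{C}$, $D\in\mathcal{D}$. *)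

(* Defs.v *)
From HB Require Import structures.
From mathcomp Require Import all_boot all_algebra.
From mathcomp Require Import ring_quotient.
From mathcomp Require Import boolp functions.
From mathcomp.multinomials Require Import freeg.

Set Implicit Arguments.
Unset Strict Implicit.
Unset Printing Implicit Defensive.

Import GRing.Theory.

Local Open Scope ring_scope.
Local Open Scope quotient_scope.

Section Exactness.
Variable S : pzRingType.

Definition exact (A B C : lmodType S) (f : A -> B) (g : B -> C) : Prop :=
  forall b : B, g b = 0 <-> exists a : A, f a = b.

Definition surjection (A B : lmodType S) (f : A -> B) : Prop :=
  forall b : B, exists a : A, f a = b.

Definition short_exact (A B C : lmodType S)
    (f : {linear A -> B}) (g : {linear B -> C}) : Prop :=
  [/\ injective f, exact f g & surjection g].

Definition trivial_module (A : lmodType S) : Prop := forall a : A, a = 0.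

End Exactness.

Section Kernel.
Variables (S : pzRingType) (A B : lmodType S) (f : {linear A -> B}).

Definition in_kernel : {pred A} := fun a => f a == 0.

Lemma in_kernel_submod_closed : submod_closed in_kernel.
Proof.
split=> [|a u v]; rewrite !unfold_in ?linear0 //.
by move=> /eqP fu /eqP fv; rewrite linearP fu fv scaler0 addr0.
Qed.

HB.instance Definition _ :=
  GRing.isSubmodClosed.Build S A in_kernel in_kernel_submod_closed.

Definition kernel : Type := {a : A | in_kernel a}.

HB.instance Definition _ := SubChoice.on kernel.
HB.instance Definition _ := [SubChoice_isSubZmodule of kernel by <:].
HB.instance Definition _ := [SubZmodule_isSubLmodule of kernel by <:].

End Kernel.

Section Cokernel.
Variables (S : pzRingType) (A B : lmodType S) (f : {linear A -> B}).

Definition in_image : {pred B} := fun b => `[< exists a : A, f a = b >].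

Lemma in_image_submod_closed : submod_closed in_image.
Proof.
split=> [|a u v]; rewrite !unfold_in; first by apply/asboolP; exists 0; rewrite linear0.
move=> /asboolP[x <-] /asboolP[y <-]; apply/asboolP.
by exists (a *: x + y); rewrite linearP.
Qed.

HB.instance Definition _ :=
  GRing.isSubmodClosed.Build S B in_image in_image_submod_closed.

Definition cokernel : Type := Quotient.quot in_image.

HB.instance Definition _ := GRing.Zmodule.on cokernel.

Definition coker_proj (b : B) : cokernel := \pi_(Quotient.quot in_image) b.

Lemma coker_projP b b' :
  coker_proj b = coker_proj b' <-> exists a, f a = b - b'.
Proof.
split=> [/eqP|h]; last apply/eqP.
  by rewrite -Quotient.idealrBE => /asboolP.
by rewrite -Quotient.idealrBE; apply/asboolP.
Qed.

Lemma coker_projD : {morph coker_proj : x y / x + y}.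
Proof. exact: (raddfD \pi_(Quotient.quot in_image)). Qed.

Lemma coker_proj_surj (q : cokernel) : exists b, coker_proj b = q.
Proof. by exists (repr (q : Quotient.quot in_image)); rewrite /coker_proj reprK. Qed.

Definition coker_scale (s : S) (q : cokernel) : cokernel :=
  coker_proj (s *: repr (q : Quotient.quot in_image)).

Lemma coker_scaleE s b : coker_scale s (coker_proj b) = coker_proj (s *: b).
Proof.
apply/coker_projP.
have /coker_projP[a fa] : coker_proj (repr (coker_proj b : Quotient.quot in_image)) = coker_proj b.
  by rewrite /coker_proj reprK.
by exists (s *: a); rewrite linearZ /= fa scalerBr.
Qed.

Lemma coker_scaleA a b v :
  coker_scale a (coker_scale b v) = coker_scale (a * b) v.
Proof. by have [x <-] := coker_proj_surj v; rewrite !coker_scaleE scalerA. Qed.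
Lemma coker_scale1 : left_id 1 coker_scale.
Proof. by move=> v; have [x <-] := coker_proj_surj v; rewrite coker_scaleE scale1r. Qed.
Lemma coker_scaleDr : right_distributive coker_scale +%R.
Proof.
move=> a u v; have [x <-] := coker_proj_surj u; have [y <-] := coker_proj_surj v.
by rewrite -coker_projD !coker_scaleE scalerDr coker_projD.
Qed.
Lemma coker_scaleDl v : {morph coker_scale^~ v : a b / a + b}.
Proof.
move=> a b; have [x <-] := coker_proj_surj v.
by rewrite !coker_scaleE scalerDl coker_projD.
Qed.

HB.instance Definition _ := GRing.Zmodule_isLmodule.Build S cokernel
  coker_scaleA coker_scale1 coker_scaleDr coker_scaleDl.

Lemma coker_proj_linear : linear coker_proj.
Proof. by move=> a u v; rewrite coker_projD -coker_scaleE. Qed.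
HB.instance Definition _ :=
  GRing.isLinear.Build S B cokernel *:%R coker_proj coker_proj_linear.

End Cokernel.

HB.mixin Record Lmodule_isBimodule (R : pzRingType) M of GRing.Lmodule R M := {
  rscale : M -> R -> M;
  rscalerA : forall m a b, rscale (rscale m a) b = rscale m (a * b);
  rscaler1 : forall m, rscale m 1 = m;
  rscalerDl : forall m m' a, rscale (m + m') a = rscale m a + rscale m' a;
  rscalerDr : forall m a b, rscale m (a + b) = rscale m a + rscale m b;
  rscaleAl : forall a m b, rscale (a *: m) b = a *: rscale m b
}.

#[short(type="bimodType")]
HB.structure Definition Bimodule (R : pzRingType) :=
  {M of GRing.Lmodule R M & Lmodule_isBimodule R M}.

Section BimoduleTheory.
Variables (R : pzRingType) (M : bimodType R).

Lemma rscale0l (a : R) : rscale (0 : M) a = 0.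
Proof. by apply: (addIr (rscale 0 a)); rewrite -rscalerDl !add0r. Qed.
Lemma rscaler0 (m : M) : rscale m 0 = 0.
Proof. by apply: (addIr (rscale m 0)); rewrite -rscalerDr !add0r. Qed.

End BimoduleTheory.

(* Hom_R(M, N) is a left R-module through the right action on M:              *)
(* (r f)(m) = f (m r).                                                        *)
Section Hom.
Variables (R : pzRingType) (M : bimodType R) (N : lmodType R).

Definition is_linear : {pred M -> N} := fun f => `[< linear f >].

Definition homM : Type := {f : M -> N | is_linear f}.

HB.instance Definition _ := SubChoice.on homM.

Lemma is_linear_zmod_closed : zmod_closed is_linear.
Proof.
split=> [|f g]; rewrite !unfold_in.
  by apply/asboolP => a u v; rewrite /= scaler0 addr0.
move=> /asboolP fl /asboolP gl; apply/asboolP => a u v.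
by rewrite /= !fctE fl gl scalerBr opprD addrACA.
Qed.

HB.instance Definition _ :=
  GRing.isZmodClosed.Build (M -> N) is_linear is_linear_zmod_closed.
HB.instance Definition _ := [SubChoice_isSubZmodule of homM by <:].

Definition hom_app (f : homM) : M -> N := val f.

Lemma hom_app_linear f : linear (hom_app f).
Proof. exact/asboolP/(valP f). Qed.
HB.instance Definition _ f :=
  GRing.isLinear.Build R M N *:%R (hom_app f) (hom_app_linear f).

Definition mk_hom (f : M -> N) (fl : linear f) : homM := Sub f (asboolT fl).

Lemma mk_homE f fl m : hom_app (@mk_hom f fl) m = f m.
Proof. by rewrite /hom_app SubK. Qed.

Lemma hom_eqP (f g : homM) : hom_app f =1 hom_app g -> f = g.
Proof. by move=> fg; apply/val_inj/funext. Qed.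

Lemma hom_addE (f g : homM) m : hom_app (f + g) m = hom_app f m + hom_app g m.
Proof. by []. Qed.

Lemma hom_scale_linear (r : R) (f : homM) :
  linear (fun m => hom_app f (rscale m r)).
Proof. by move=> a u v; rewrite rscalerDl rscaleAl linearP. Qed.

Definition hom_scale (r : R) (f : homM) : homM := mk_hom (hom_scale_linear r f).

Lemma hom_scaleA a b f : hom_scale a (hom_scale b f) = hom_scale (a * b) f.
Proof. by apply: hom_eqP => m; rewrite !mk_homE rscalerA. Qed.
Lemma hom_scale1 : left_id 1 hom_scale.
Proof. by move=> f; apply: hom_eqP => m; rewrite mk_homE rscaler1. Qed.
Lemma hom_scaleDr : right_distributive hom_scale +%R.
Proof. by move=> a f g; apply: hom_eqP => m; rewrite hom_addE !mk_homE. Qed.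
Lemma hom_scaleDl f : {morph hom_scale^~ f : a b / a + b}.
Proof.
by move=> a b; apply: hom_eqP => m; rewrite hom_addE !mk_homE rscalerDr linearD.
Qed.

HB.instance Definition _ := GRing.Zmodule_isLmodule.Build R homM
  hom_scaleA hom_scale1 hom_scaleDr hom_scaleDl.

End Hom.

Section HomMap.
Variables (R : pzRingType) (M : bimodType R) (N N' : lmodType R).
Variable (g : {linear N -> N'}).

Lemma hom_map_subproof (f : homM M N) : linear (fun m => g (hom_app f m)).
Proof. by move=> a u v; rewrite !linearP. Qed.

Definition hom_map (f : homM M N) : homM M N' := mk_hom (hom_map_subproof f).

Lemma hom_map_linear : linear hom_map.
Proof.
move=> a u v; apply: hom_eqP => m.
by rewrite hom_addE /= !mk_homE -linearD /=.
Qed.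
HB.instance Definition _ :=
  GRing.isLinear.Build R (homM M N) (homM M N') *:%R hom_map hom_map_linear.

End HomMap.

(* M (x)_R X is the quotient of the free abelian group on M * X by the        *)
(* subgroup generated by the relations below; its universal property is       *)
(* tensor_liftE and tensor_lift_unique, and R acts by                         *)
(* r (m (x) x) = (r m) (x) x.                                                 *)
Section Tensor.
Variables (R : pzRingType) (M : bimodType R) (X : lmodType R).

Inductive tensor_rel : {freeg (M * X)%type} -> Prop :=
| TensorRel0 : tensor_rel 0
| TensorRelB u v : tensor_rel u -> tensor_rel v -> tensor_rel (u - v)
| TensorRelDl m m' x :
    tensor_rel (<< (m + m', x) >> - << (m, x) >> - << (m', x) >>)
| TensorRelDr m x x' :
    tensor_rel (<< (m, x + x') >> - << (m, x) >> - << (m, x') >>)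
| TensorRelA m r x :
    tensor_rel (<< (rscale m r, x) >> - << (m, r *: x) >>).

Definition in_tensor_rel : {pred {freeg (M * X)%type}} :=
  fun u => `[< tensor_rel u >].

Lemma in_tensor_rel_zmod_closed : zmod_closed in_tensor_rel.
Proof.
split=> [|u v]; rewrite !unfold_in; first by apply/asboolP; exact: TensorRel0.
by move=> /asboolP hu /asboolP hv; apply/asboolP; exact: TensorRelB.
Qed.

HB.instance Definition _ :=
  GRing.isZmodClosed.Build {freeg (M * X)%type} in_tensor_rel in_tensor_rel_zmod_closed.

Definition tensor : Type := Quotient.quot in_tensor_rel.

HB.instance Definition _ := GRing.Zmodule.on tensor.

Definition tensor_proj (u : {freeg (M * X)%type}) : tensor :=
  \pi_(Quotient.quot in_tensor_rel) u.

Definition tens (m : M) (x : X) : tensor := tensor_proj << (m, x) >>.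

Lemma tensor_projP u v : tensor_proj u = tensor_proj v <-> tensor_rel (u - v).
Proof.
split=> [/eqP|h]; last apply/eqP.
  by rewrite -Quotient.idealrBE => /asboolP.
by rewrite -Quotient.idealrBE; apply/asboolP.
Qed.

Lemma tensor_projB : {morph tensor_proj : u v / u - v}.
Proof. exact: (raddfB \pi_(Quotient.quot in_tensor_rel)). Qed.

Lemma tensor_projD : {morph tensor_proj : u v / u + v}.
Proof. exact: (raddfD \pi_(Quotient.quot in_tensor_rel)). Qed.

Lemma tensDl m m' x : tens (m + m') x = tens m x + tens m' x.
Proof.
rewrite /tens -tensor_projD; apply/tensor_projP.
by rewrite opprD addrA; exact: TensorRelDl.
Qed.

Lemma tensDr m x x' : tens m (x + x') = tens m x + tens m x'.
Proof.
rewrite /tens -tensor_projD; apply/tensor_projP.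
by rewrite opprD addrA; exact: TensorRelDr.
Qed.

Lemma tensA m r x : tens (rscale m r) x = tens m (r *: x).
Proof. by apply/tensor_projP; exact: TensorRelA. Qed.

Lemma tensor_proj_surj (t : tensor) : exists u, tensor_proj u = t.
Proof.
by exists (repr (t : Quotient.quot in_tensor_rel)); rewrite /tensor_proj reprK.
Qed.

Lemma tensor_ind (P : tensor -> Prop) :
    (forall m x, P (tens m x)) -> (forall t t', P t -> P t' -> P (t - t')) ->
  forall t, P t.
Proof.
move=> Pt PB; have P0 : P 0 by rewrite -(subrr (tens 0 0)); apply: PB.
have PD t t' : P t -> P t' -> P (t + t').
  by move=> Ht Ht'; rewrite -[t']opprK -[- t']sub0r; apply: (PB) => //; apply: PB.
move=> t; have [u <-] := tensor_proj_surj t.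
have proj0 : tensor_proj 0 = 0 by exact: (raddf0 \pi_(Quotient.quot in_tensor_rel)).
rewrite -[u]freeg_sumE; elim/big_ind: _ => [|v w Pv Pw|[m x] _].
- by rewrite proj0.
- by rewrite tensor_projD; apply: PD.
set k := coeff _ _; have -> : << k *g (m, x) >> = << (m, x) >> *~ k :> {freeg (M * X)%type}.
  by rewrite freegU_mulz intz.
have Pn n : P (tensor_proj (<< (m, x) >> *+ n)).
  elim: n => [|n IHn]; first by rewrite mulr0n proj0.
  by rewrite mulrS tensor_projD; apply: PD => //; apply: Pt.
case: k => n; first exact: Pn.
by rewrite NegzE mulrNz -sub0r tensor_projB proj0; apply: PB => //; apply: Pn.
Qed.

End Tensor.

Section TensorLift.
Variables (R : pzRingType) (M : bimodType R) (X : lmodType R).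

Definition balanced (A : zmodType) (phi : M -> X -> A) : Prop :=
  [/\ forall m m' x, phi (m + m') x = phi m x + phi m' x,
      forall m x x', phi m (x + x') = phi m x + phi m x' &
      forall m r x, phi (rscale m r) x = phi m (r *: x)].

Section ToGroup.
Variables (A : zmodType) (phi : M -> X -> A).

Let phi' (p : (M * X)%type) : zmodule A := phi p.1 p.2.

Definition tensor_lift (t : tensor M X) : A :=
  fglift phi' (repr (t : Quotient.quot (@in_tensor_rel R M X))).

Hypothesis phi_bal : balanced phi.

Lemma tensor_lift_proj u : tensor_lift (tensor_proj u) = fglift phi' u.
Proof.
have [phiDl phiDr phiA] := phi_bal.
set v := repr (tensor_proj u : Quotient.quot (@in_tensor_rel R M X)).
have : tensor_rel (v - u) by apply/tensor_projP; rewrite /tensor_proj reprK.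
have liftB := lift_is_additive phi'.
rewrite /tensor_lift -/v => h; apply/eqP; rewrite -subr_eq0 -[_ - _]liftB.
apply/eqP; elim: h => [|a b _ IHa _ IHb|m m' x|m x x'|m r x].
- by rewrite -[X in fglift _ X](subrr 0) liftB subrr.
- by rewrite liftB IHa IHb subr0.
- by rewrite !liftB !liftU !scale1r /phi' /= phiDl -addrA -opprD subrr.
- by rewrite !liftB !liftU !scale1r /phi' /= phiDr -addrA -opprD subrr.
- by rewrite liftB !liftU !scale1r /phi' /= phiA subrr.
Qed.

Lemma tensor_liftE m x : tensor_lift (tens m x) = phi m x.
Proof. by rewrite /tens tensor_lift_proj liftU scale1r. Qed.

Lemma tensor_lift_additive : {morph tensor_lift : t t' / t - t'}.
Proof.
move=> t t'; have [u <-] := tensor_proj_surj t; have [v <-] := tensor_proj_surj t'.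
by rewrite -tensor_projB !tensor_lift_proj; exact: (lift_is_additive phi').
Qed.

Lemma tensor_lift_unique (g : tensor M X -> A) :
  {morph g : t t' / t - t'} -> (forall m x, g (tens m x) = phi m x) ->
  g =1 tensor_lift.
Proof.
move=> gB gE; apply: tensor_ind => [m x|t t' IHt IHt'].
  by rewrite gE tensor_liftE.
by rewrite gB tensor_lift_additive IHt IHt'.
Qed.

End ToGroup.
End TensorLift.

Section TensorModule.
Variables (R : pzRingType) (M : bimodType R) (X : lmodType R).
Local Notation T := (tensor M X).

Definition tensor_scale (r : R) : T -> T :=
  tensor_lift (fun m x => tens (r *: m) x).

Lemma tensor_scale_balanced r : balanced (fun m (x : X) => tens (r *: m : M) x).
Proof.
split=> [m m' x|m x x'|m s x]; first by rewrite scalerDr tensDl.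
  by rewrite tensDr.
by rewrite -tensA rscaleAl.
Qed.

Lemma tensor_scaleE r m x : tensor_scale r (tens m x) = tens (r *: m) x.
Proof. exact: (tensor_liftE (tensor_scale_balanced r)). Qed.

Lemma tensor_scaleB r : {morph tensor_scale r : t t' / t - t'}.
Proof. exact: (tensor_lift_additive (tensor_scale_balanced r)). Qed.

Lemma tensor_scaleA a b t :
  tensor_scale a (tensor_scale b t) = tensor_scale (a * b) t.
Proof.
elim/tensor_ind: t => [m x|t t' IHt IHt']; first by rewrite !tensor_scaleE scalerA.
by rewrite !tensor_scaleB IHt IHt'.
Qed.
Lemma tensor_scale1 : left_id 1 tensor_scale.
Proof.
elim/tensor_ind => [m x|t t' IHt IHt']; first by rewrite !tensor_scaleE scale1r.
by rewrite !tensor_scaleB IHt IHt'.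
Qed.
Lemma tensor_scaleDr : right_distributive tensor_scale +%R.
Proof.
move=> a u v; have sN w : tensor_scale a (- w) = - tensor_scale a w.
  by rewrite -[- w]sub0r -(subrr 0) !tensor_scaleB subrr sub0r.
by rewrite -[v]opprK tensor_scaleB sN !opprK.
Qed.
Lemma tensor_scaleDl t : {morph tensor_scale^~ t : a b / a + b}.
Proof.
move=> a b; elim/tensor_ind: t => [m x|t t' IHt IHt'].
  by rewrite !tensor_scaleE scalerDl tensDl.
by rewrite !tensor_scaleB IHt IHt' opprD addrACA.
Qed.

HB.instance Definition _ := GRing.Zmodule_isLmodule.Build R T
  tensor_scaleA tensor_scale1 tensor_scaleDr tensor_scaleDl.

Lemma tensZl r m x : r *: tens m x = tens (r *: m) x :> T.
Proof. exact: tensor_scaleE. Qed.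

Lemma tensor_lift_linear (A : lmodType R) (phi : M -> X -> A) :
  balanced phi -> (forall r m x, phi (r *: m) x = r *: phi m x) ->
  linear (tensor_lift phi).
Proof.
move=> phiB phiZ a u v.
have lB := tensor_lift_additive phiB.
have lZ t : tensor_lift phi (a *: t) = a *: tensor_lift phi t.
  elim/tensor_ind: t => [m x|t t' IHt IHt'].
    by rewrite tensZl !tensor_liftE.
  by rewrite scalerBr !lB IHt IHt' scalerBr.
have lN w : tensor_lift phi (- w) = - tensor_lift phi w.
  by rewrite -[- w]sub0r -(subrr 0) !lB subrr sub0r.
by rewrite -[v]opprK lB lZ lN !opprK.
Qed.

End TensorModule.

Section TensorMap.
Variables (R : pzRingType) (M : bimodType R) (X X' : lmodType R).
Variable (f : {linear X -> X'}).

Definition tensor_map : tensor M X -> tensor M X' :=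
  tensor_lift (fun m x => tens m (f x)).

Lemma tensor_map_balanced : balanced (fun (m : M) (x : X) => tens m (f x)).
Proof.
split=> [m m' x|m x x'|m s x]; first by rewrite tensDl.
  by rewrite linearD tensDr.
by rewrite tensA linearZ.
Qed.

Lemma tensor_mapE m x : tensor_map (tens m x) = tens m (f x).
Proof. exact: (tensor_liftE tensor_map_balanced). Qed.

Lemma tensor_map_linear : linear tensor_map.
Proof.
by apply: (tensor_lift_linear tensor_map_balanced) => r m x; rewrite tensZl.
Qed.
HB.instance Definition _ :=
  GRing.isLinear.Build R (tensor M X) (tensor M X') *:%R tensor_map tensor_map_linear.

End TensorMap.
Arguments tensor_map {R} M {X X'} f t.

Section TrivialExtension.
Variables (R : pzRingType) (M : bimodType R).

Definition trivext : Type := (R * M)%type.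

HB.instance Definition _ := GRing.Zmodule.copy trivext (R * M)%type.

Definition trivext_mul (a b : trivext) : trivext :=
  (a.1 * b.1, a.1 *: b.2 + rscale a.2 b.1).

Lemma trivext_mulA : associative trivext_mul.
Proof.
move=> a b c; rewrite /trivext_mul /=; congr pair; first exact: mulrA.
by rewrite scalerDr scalerA rscalerDl rscaleAl rscalerA addrA.
Qed.
Lemma trivext_mul1 : left_id (1, 0) trivext_mul.
Proof. by case=> a m; rewrite /trivext_mul /= mul1r scale1r rscale0l addr0. Qed.
Lemma trivext_mulr1 : right_id (1, 0) trivext_mul.
Proof. by case=> a m; rewrite /trivext_mul /= mulr1 scaler0 add0r rscaler1. Qed.
Lemma trivext_mulDl : left_distributive trivext_mul +%R.
Proof.
case=> [a m] [b m'] [c m'']; rewrite /trivext_mul /=; congr pair; first exact: mulrDl.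
by rewrite /= scalerDl rscalerDl addrACA.
Qed.
Lemma trivext_mulDr : right_distributive trivext_mul +%R.
Proof.
case=> [a m] [b m'] [c m'']; rewrite /trivext_mul /=; congr pair; first exact: mulrDr.
by rewrite /= scalerDr rscalerDr addrACA.
Qed.

HB.instance Definition _ := GRing.Zmodule_isPzRing.Build trivext
  trivext_mulA trivext_mul1 trivext_mulr1 trivext_mulDl trivext_mulDr.

Definition tinl (r : R) : trivext := (r, 0).
Definition tinr (m : M) : trivext := (0, m).

Lemma tinlD r s : tinl (r + s) = tinl r + tinl s.
Proof. by congr pair; rewrite /= addr0. Qed.
Lemma tinrD m m' : tinr (m + m') = tinr m + tinr m'.
Proof. by congr pair; rewrite /= addr0. Qed.
Lemma tinlM r s : tinl r * tinl s = tinl (r * s).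
Proof. by congr pair; rewrite /= scaler0 rscale0l addr0. Qed.
Lemma tinlr r m : tinl r * tinr m = tinr (r *: m).
Proof. by congr pair; rewrite /= ?mulr0 // rscaler0 addr0. Qed.
Lemma tinrl m r : tinr m * tinl r = tinr (rscale m r).
Proof. by congr pair; rewrite /= ?mul0r // scaler0 add0r. Qed.
Lemma tinrr m m' : tinr m * tinr m' = 0.
Proof. by congr pair; rewrite /= ?mul0r // scale0r rscaler0 addr0. Qed.

End TrivialExtension.

(* A left module X over the trivial extension is read as the pair (res X,     *)
(* alpha X), or equivalently as the pair [res X, beta X], as follows.         *)

Section Restriction.
Variables (R : pzRingType) (M : bimodType R) (X : lmodType (trivext M)).

Definition res : Type := X.

HB.instance Definition _ := GRing.Zmodule.on res.

Definition res_scale (r : R) (x : res) : res := tinl M r *: (x : X).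

Lemma res_scaleA a b x : res_scale a (res_scale b x) = res_scale (a * b) x.
Proof. by rewrite /res_scale scalerA tinlM. Qed.
Lemma res_scale1 : left_id 1 res_scale.
Proof. exact: (@scale1r _ X). Qed.
Lemma res_scaleDr : right_distributive res_scale +%R.
Proof. by move=> a u v; exact: (@scalerDr _ X). Qed.
Lemma res_scaleDl x : {morph res_scale^~ x : a b / a + b}.
Proof. by move=> a b; rewrite /res_scale tinlD scalerDl. Qed.

HB.instance Definition _ := GRing.Zmodule_isLmodule.Build R res
  res_scaleA res_scale1 res_scaleDr res_scaleDl.

Definition mact (m : M) (x : res) : res := tinr m *: (x : X).

Lemma mactDl m m' x : mact (m + m') x = mact m x + mact m' x.
Proof. by rewrite /mact tinrD scalerDl. Qed.
Lemma mactDr m x y : mact m (x + y) = mact m x + mact m y.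
Proof. exact: (@scalerDr _ X). Qed.
Lemma mactBr m x y : mact m (x - y) = mact m x - mact m y.
Proof. exact: (@scalerBr _ X). Qed.
Lemma mactA m r x : mact (rscale m r) x = mact m (r *: x).
Proof. by rewrite /mact -tinrl; exact/esym/(@scalerA _ X). Qed.
Lemma mactZl r m x : mact (r *: m) x = r *: mact m x.
Proof. by rewrite /mact -tinlr; exact/esym/(@scalerA _ X). Qed.
Lemma mact_mact m m' x : mact m (mact m' x) = 0.
Proof. by rewrite /mact scalerA tinrr scale0r. Qed.

Lemma mact_balanced : balanced mact.
Proof. by split; [exact: mactDl | exact: mactDr | exact: mactA]. Qed.

Definition alpha_fun : tensor M res -> res := tensor_lift mact.

Lemma alpha_linear : linear alpha_fun.
Proof. exact: (tensor_lift_linear mact_balanced mactZl). Qed.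
HB.instance Definition _ :=
  GRing.isLinear.Build R (tensor M res) res *:%R alpha_fun alpha_linear.

Definition alpha : {linear tensor M res -> res} := alpha_fun.

Lemma alphaE m x : alpha (tens m x) = mact m x.
Proof. exact: (tensor_liftE mact_balanced). Qed.

Lemma beta_subproof (x : res) : linear (mact^~ x).
Proof. by move=> a u v; rewrite mactDl mactZl. Qed.

Definition beta_fun (x : res) : homM M res := mk_hom (beta_subproof x).

Lemma beta_linear : linear beta_fun.
Proof.
move=> a u v; apply: hom_eqP => m.
by rewrite hom_addE !mk_homE mactDr mactA.
Qed.
HB.instance Definition _ :=
  GRing.isLinear.Build R res (homM M res) *:%R beta_fun beta_linear.

Definition beta : {linear res -> homM M res} := beta_fun.

Lemma betaE x m : hom_app (beta x) m = mact m x.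
Proof. exact: mk_homE. Qed.

Lemma alpha_alpha t : alpha (tensor_map M alpha t) = 0.
Proof.
elim/tensor_ind: t => [m t|t t' IHt IHt']; last by rewrite !linearB /= IHt IHt' subr0.
rewrite tensor_mapE alphaE; elim/tensor_ind: t => [m' x|t t' IHt IHt'].
  by rewrite alphaE mact_mact.
by rewrite linearB /= mactBr IHt IHt' subr0.
Qed.

Lemma beta_beta x : hom_map beta (beta x) = 0.
Proof.
by apply: hom_eqP => m; rewrite mk_homE; apply: hom_eqP => m'; rewrite !mk_homE mact_mact.
Qed.

End Restriction.
Arguments alpha {R M} X.
Arguments beta {R M} X.

Section Resolutions.
Variable S : pzRingType.

Record resolution (A : lmodType S) := Resolution {
  term : nat -> lmodType S;
  diff : forall i, {linear term i.+1 -> term i};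
  aug : {linear term 0 -> A};
  aug_surj : surjection aug;
  aug_exact : exact (diff 0) aug;
  diff_exact : forall i, exact (diff i.+1) (diff i)
}.

Record coresolution (A : lmodType S) := Coresolution {
  coterm : nat -> lmodType S;
  codiff : forall i, {linear coterm i -> coterm i.+1};
  coaug : {linear A -> coterm 0};
  coaug_inj : injective coaug;
  coaug_exact : exact coaug (codiff 0);
  codiff_exact : forall i, exact (codiff i) (codiff i.+1)
}.

Definition projective (P : lmodType S) : Prop :=
  forall (A B : lmodType S) (f : {linear A -> B}) (g : {linear P -> B}),
    surjection f -> exists h : {linear P -> A}, forall x, f (h x) = g x.

Definition projective_resolution A (P : resolution A) : Prop :=
  forall i, projective (term P i).

(* Ext^i_S(A, B) = 0: the complex Hom_S(term P 0, B) -> Hom_S(term P 1, B) -> *)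
(* ... has zero cohomology in degree i, for every projective resolution P of  *)
(* A (such a P exists, see exists_projective_resolution below).               *)
Definition Ext_zero (i : nat) (A B : lmodType S) : Prop :=
  forall P : resolution A, projective_resolution P ->
    match i with
    | 0 => forall f : {linear term P 0 -> B},
        (forall x, f (diff P 0 x) = 0) -> forall x, f x = 0
    | j.+1 => forall f : {linear term P j.+1 -> B},
        (forall x, f (diff P j.+1 x) = 0) ->
        exists g : {linear term P j -> B}, forall x, f x = g (diff P j x)
    end.

End Resolutions.

(* Tor_i^R(M, C) = 0: the complex ... -> M (x) term P 1 -> M (x) term P 0 has  *)
(* zero homology in degree i, for every projective resolution P of C.          *)
Definition Tor_zero (R : pzRingType) (i : nat) (M : bimodType R)
    (C : lmodType R) : Prop :=
  forall P : resolution C, projective_resolution P ->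
    match i with
    | 0 => surjection (tensor_map M (diff P 0))
    | j.+1 => exact (tensor_map M (diff P j.+1)) (tensor_map M (diff P j))
    end.

Section FreeModule.
Variables (S : pzRingType) (T : choiceType).

Definition fin_supp : {pred T -> S^o} :=
  fun f => `[< exists s : seq T, forall x, x \notin s -> f x = 0 >].

Lemma fin_supp_submod_closed : submod_closed fin_supp.
Proof.
split=> [|a u v]; rewrite !unfold_in; first by apply/asboolP; exists [::].
move=> /asboolP[s us] /asboolP[s' vs']; apply/asboolP; exists (s ++ s') => x.
by rewrite mem_cat negb_or => /andP[/us ux /vs' vx]; rewrite !fctE ux vx scaler0 addr0.
Qed.

HB.instance Definition _ :=
  GRing.isSubmodClosed.Build S (T -> S^o) fin_supp fin_supp_submod_closed.

Definition freemod : Type := {f : T -> S^o | fin_supp f}.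

HB.instance Definition _ := SubChoice.on freemod.
HB.instance Definition _ := [SubChoice_isSubZmodule of freemod by <:].
HB.instance Definition _ := [SubZmodule_isSubLmodule of freemod by <:].

Definition free_coef (f : freemod) : T -> S := val f.

Lemma free_gen_subproof (t : T) : fin_supp (fun x => (x == t)%:R).
Proof.
by apply/asboolP; exists [:: t] => x; rewrite inE => /negPf ->.
Qed.
Definition free_gen (t : T) : freemod := Sub _ (free_gen_subproof t).

Definition free_supp (f : freemod) : seq T :=
  undup (projT1 (cid (asboolW (valP f)))).

Lemma free_suppP f x : x \notin free_supp f -> free_coef f x = 0.
Proof. by rewrite mem_undup => /(projT2 (cid (asboolW (valP f)))). Qed.

Section Lift.
Variables (A : lmodType S) (g : T -> A).

Definition free_lift (f : freemod) : A :=
  \sum_(x <- free_supp f) free_coef f x *: g x.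

Lemma free_liftE (f : freemod) (s : seq T) : uniq s ->
  (forall x, x \notin s -> free_coef f x = 0) ->
  free_lift f = \sum_(x <- s) free_coef f x *: g x.
Proof.
move=> us fs; rewrite /free_lift.
have E r : \sum_(x <- r) free_coef f x *: g x =
    \sum_(x <- [seq x <- r | free_coef f x != 0]) free_coef f x *: g x.
  rewrite big_filter [RHS]big_mkcond; apply: eq_bigr => x _.
  by case: eqP => //= ->; rewrite scale0r.
rewrite E [RHS]E; apply/perm_big/uniq_perm; rewrite ?filter_uniq ?undup_uniq //.
move=> x; rewrite !mem_filter; case: eqP => //= /eqP fx.
have -> : x \in free_supp f by apply: contraNT fx => /free_suppP ->.
by apply/esym; apply: contraNT fx => /fs ->.
Qed.

Lemma free_lift_linear : linear free_lift.
Proof.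
move=> a u v; pose s := undup (free_supp u ++ free_supp v).
have us : uniq s by exact: undup_uniq.
have su x : x \notin s -> free_coef u x = 0.
  by rewrite mem_undup mem_cat negb_or => /andP[/free_suppP].
have sv x : x \notin s -> free_coef v x = 0.
  by rewrite mem_undup mem_cat negb_or => /andP[_ /free_suppP].
have auv x : free_coef (a *: u + v) x = a * free_coef u x + free_coef v x by [].
rewrite (free_liftE us su) (free_liftE us sv) (@free_liftE _ s us); last first.
  by move=> x xs; rewrite auv su // sv // mulr0 addr0.
rewrite scaler_sumr -big_split; apply: eq_bigr => x _.
by rewrite auv scalerDl scalerA.
Qed.
HB.instance Definition _ :=
  GRing.isLinear.Build S freemod A *:%R free_lift free_lift_linear.

Lemma free_lift_gen t : free_lift (free_gen t) = g t.
Proof.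
rewrite (@free_liftE _ [:: t]) // => [|x].
  by rewrite big_seq1 /free_coef /= eqxx scale1r.
by rewrite inE /free_coef /= => /negPf ->.
Qed.

Lemma free_lift_unique (h : {linear freemod -> A}) :
  (forall t, h (free_gen t) = g t) -> h =1 free_lift.
Proof.
move=> hg f.
have -> : f = \sum_(x <- free_supp f) free_coef f x *: free_gen x.
  apply/val_inj/funext => t; rewrite raddf_sum fct_sumE /=.
  transitivity (\sum_(x <- free_supp f) free_coef f x * (t == x)%:R); last first.
    by apply: eq_bigr.
  have [tf|tf] := boolP (t \in free_supp f).
    rewrite (bigD1_seq t) ?undup_uniq //= eqxx mulr1 big1 ?addr0 // => x.
    by rewrite eq_sym => /negPf ->; rewrite mulr0.
  rewrite [LHS](free_suppP tf) big_seq big1 // => x xf.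
  by case: eqP => [tx|]; rewrite ?mulr0 //; rewrite tx xf in tf.
rewrite !linear_sum; apply: eq_bigr => x _.
by rewrite !linearZ /= hg free_lift_gen.
Qed.

End Lift.

Lemma free_projective : projective freemod.
Proof.
move=> A B f g fS.
pose h0 t := projT1 (cid (fS (g (free_gen t)))).
have h0P t : f (h0 t) = g (free_gen t) by exact: projT2 (cid (fS (g (free_gen t)))).
exists (free_lift h0) => x.
rewrite (@free_lift_unique _ _ g (fun t => erefl)).
apply: (@free_lift_unique _ _ (f \o free_lift h0 : {linear freemod -> B})) => t.
by rewrite /= free_lift_gen h0P.
Qed.

End FreeModule.

Section CanonicalResolution.
Variable S : pzRingType.

Definition free_cover (A : lmodType S) : {linear freemod S A -> A} := free_lift id.

Lemma free_cover_surj A : surjection (free_cover A).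
Proof. by move=> a; exists (free_gen S a); exact: free_lift_gen. Qed.

Fixpoint syzygy (A : lmodType S) (n : nat) : lmodType S :=
  if n is n'.+1 then kernel (free_cover (syzygy A n')) else A.

Definition kernel_incl (A B : lmodType S) (f : {linear A -> B}) :
  {linear kernel f -> A} := val.

Lemma exists_projective_resolution (A : lmodType S) :
  exists P : resolution A, projective_resolution P.
Proof.
pose P n : lmodType S := freemod S (syzygy A n).
pose d n : {linear P n.+1 -> P n} :=
  kernel_incl (free_cover (syzygy A n)) \o free_cover (syzygy A n.+1).
have dE n (b : P n) :
    free_cover (syzygy A n) b = 0 <-> exists a, d n a = b.
  split=> [b0|[a <-]]; last exact/eqP/(valP (free_cover (syzygy A n.+1) a)).
  have kb : in_kernel (free_cover (syzygy A n)) b by apply/eqP.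
  have [a ab] := @free_cover_surj (syzygy A n.+1) (Sub b kb).
  by exists a; rewrite /d /= ab.
have dd n : exact (d n.+1) (d n).
  move=> b; rewrite -dE; split=> [h|h]; first exact/val_inj.
  by rewrite -[RHS](linear0 (kernel_incl (free_cover (syzygy A n)))) -h.
exists (@Resolution S A P d (free_cover A) (@free_cover_surj A) (dE 0) dd) => n.
exact: free_projective.
Qed.

End CanonicalResolution.

Section Classes.
Variable S : pzRingType.

Definition modclass := lmodType S -> Prop.

Definition closed_under_iso (C : modclass) : Prop :=
  forall (A B : lmodType S) (f : {linear A -> B}), bijective f -> C A -> C B.

Definition is_class (C : modclass) : Prop :=
  (forall Z : lmodType S, trivial_module Z -> C Z) /\ closed_under_iso C.

Definition closed_under_summands (C : modclass) : Prop :=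
  forall (X A B : lmodType S) (f : {linear (A * B)%type -> X}),
    bijective f -> C X -> C A.

Definition closed_under_extensions (C : modclass) : Prop :=
  forall (A B E : lmodType S) (f : {linear A -> E}) (g : {linear E -> B}),
    short_exact f g -> C A -> C B -> C E.

(* C_m^/\ : 0 -> C_k -> ... -> C_0 -> A -> 0 exact for some k <= m, seen as a *)
(* resolution of A that vanishes beyond k                                     *)
Definition wedge (C : modclass) (m : nat) : modclass := fun A =>
  exists (k : nat) (X : resolution A),
    [/\ (k <= m)%N, forall i, (i <= k)%N -> C (term X i)
      & forall i, (k < i)%N -> trivial_module (term X i)].

Definition vee (C : modclass) (m : nat) : modclass := fun A =>
  exists (k : nat) (X : coresolution A),
    [/\ (k <= m)%N, forall i, (i <= k)%N -> C (coterm X i)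
      & forall i, (k < i)%N -> trivial_module (coterm X i)].

Definition Ext_orthogonal (n : nat) (C D : modclass) : Prop :=
  forall (i : nat) (X Y : lmodType S), (1 <= i <= n)%N -> C X -> D Y -> Ext_zero i X Y.

Definition left_cotorsion_pair (n : nat) (C D : modclass) : Prop :=
  [/\ closed_under_summands C,
      Ext_orthogonal n C D
    & forall A : lmodType S,
        exists (K X : lmodType S) (f : {linear K -> X}) (g : {linear X -> A}),
          [/\ short_exact f g, C X & wedge D n.-1 K]].

Definition right_cotorsion_pair (n : nat) (C D : modclass) : Prop :=
  [/\ closed_under_summands D,
      Ext_orthogonal n C D
    & forall A : lmodType S,
        exists (Y K : lmodType S) (f : {linear A -> Y}) (g : {linear Y -> K}),
          [/\ short_exact f g, D Y & vee C n.-1 K]].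

Definition hereditary (n : nat) (C D : modclass) : Prop :=
  forall X Y : lmodType S, C X -> D Y -> Ext_zero n.+1 X Y.

End Classes.

Section TrivextClasses.
Variables (R : pzRingType) (M : bimodType R) (C : modclass R).

Definition Uclass : modclass (trivext M) := fun X => C (res X).

Definition Bclass : modclass (trivext M) := fun X =>
  C (cokernel (alpha X)) /\
  exact (tensor_map M (alpha X)) (alpha X).

Definition Jclass : modclass (trivext M) := fun Y =>
  C (kernel (beta Y)) /\
  exact (beta Y) (hom_map (beta Y)).

End TrivextClasses.
Arguments Uclass {R} M C.
Arguments Bclass {R} M C.
Arguments Jclass {R} M C.

(* Main.v *)
Require Import Defs.
From mathcomp Require Import all_boot all_algebra.
From HB Require Import structures.
From mathcomp Require Import boolp.

(** Every module $X$ over $R$ is the module $Z(X) = (X, 0)$ over $R \ltimes M$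
    ([triv]), and [res] forgets the action of $M$. Both are exact and the composite
    [res] after $Z$ is isomorphic to the identity, so approximation sequences over
    $R \ltimes M$, taken at $Z(A)$, give approximation sequences of $A$ over
    $R$ ([res_short_exact]), and closure properties of the classes
    $\mathfrak U^{\mathcal C}$ restrict to $\mathcal C$ along $Z$
    ([triv_ses], [Uclass_summands]). Three points need an argument.

    Finite resolutions. If $K$ has a finite resolution by modules of
    $\mathfrak J^{\mathcal D}$, then $\mathrm{Ker}\,\beta_K$ has one of the same
    length by modules of $\mathcal D$, and $K$ satisfies the exactness condition
    of $\mathfrak J$ ([finite_res_Jclass]): taking $\mathrm{Ker}\,\beta$ turns
    $0 \to L \to X \to K \to 0$ into a short exact sequence as soon as $L$
    satisfies the condition, and $K$ inherits it because
    $\mathrm{Ext}^1(M, \mathrm{Ker}\,\beta_L) = 0$, by dimension shifting from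
    $\mathrm{Ext}^i(M, \mathcal D) = 0$. The condition on $K$ says precisely
    that $0 \to \mathrm{Ker}\,\beta_K \to K \to
    \mathrm{Hom}(M, \mathrm{Ker}\,\beta_K) \to 0$ is exact ([beta_ses]);
    the outer terms have finite $\mathcal D$-resolutions ([finite_res_hom]),
    hence so does $K$. The dual argument for $\mathfrak B^{\mathcal C}$ uses
    $\mathrm{Coker}\,\alpha$ and $M \otimes -$ ([finite_cores_Bclass],
    [alpha_ses], [finite_cores_tensor]).

    Ext in degree one. An extension $0 \to K \to E \to A \to 0$ of $R$-modules
    lifts to an extension of $Z(A)$ by the coinduced module
    $K \times \mathrm{Hom}(M, K)$, with middle term
    $E \times \mathrm{Hom}(M, K)$ ([homext_ses]), and to an extension of the
    induced module $A \times (M \otimes A)$ by $Z(K)$, with middle term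
    $E \times (M \otimes A)$ ([tensext_ses]). The coinduced module lies in
    $\mathfrak J^{\mathcal D}$ when $K \in \mathcal D$, and the induced one in
    $\mathfrak B^{\mathcal C}$ when $A \in \mathcal C$; so
    $\mathrm{Ext}^1 = 0$ passes from $R \ltimes M$ to $R$.

    Ext in higher degrees. In a left $n$-cotorsion pair the left class is the
    class of all $X$ with $\mathrm{Ext}^i(X, D) = 0$ for $1 \leqslant i \leqslant n$
    ([left_cotorsion_mem]); if the pair is hereditary, this makes it closed
    under kernels of epimorphisms ([left_closed_kernels]). Hence $\mathcal C$
    is closed under such kernels, and it contains the projective modules, so
    syzygies of $\mathcal C$ stay in $\mathcal C$ and vanishing of
    $\mathrm{Ext}^1_R(\mathcal C, \mathcal D)$ propagates to all degrees. For a
    right pair, $\mathcal D$ is closed under cokernels of monomorphisms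
    ([right_closed_cokernels]) and every module embeds into one of
    $\mathcal D$, which plays the part of an injective hull: a class in
    $\mathrm{Ext}^{i+1}(C, D)$ dies in some extension of $D$, hence in some
    $D' \in \mathcal D$ containing it, and so comes from
    $\mathrm{Ext}^i(C, D'/D) = 0$ ([Ext_zeroSS_embed]). *)

Set Implicit Arguments.
Unset Strict Implicit.
Unset Printing Implicit Defensive.
Import GRing.Theory.
Local Open Scope ring_scope.

(** * Linear maps, short exact sequences and projective modules *)

Arguments kernel_incl : simpl never.

Section LinearMaps.
Variable S : pzRingType.
Implicit Types A B C E K P Q Z : lmodType S.

Definition lin A B (f : A -> B) (fl : linear f) : {linear A -> B} :=
  HB.pack f (GRing.isLinear.Build S A B *:%R f fl).

Lemma inl_linear A B : linear (fun a : A => (a, 0) : (A * B)%type).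
Proof. by move=> s x y; congr pair; rewrite /= scaler0 addr0. Qed.
Definition prod_inl A B := lin (@inl_linear A B).

Lemma inr_linear A B : linear (fun b : B => (0, b) : (A * B)%type).
Proof. by move=> s x y; congr pair; rewrite /= scaler0 addr0. Qed.
Definition prod_inr A B := lin (@inr_linear A B).

Lemma copair_linear A B C (f : {linear A -> C}) (g : {linear B -> C}) :
  linear (fun p : (A * B)%type => f p.1 + g p.2).
Proof. by move=> s x y /=; rewrite !linearP scalerDr addrACA. Qed.
Definition copair A B C (f : {linear A -> C}) (g : {linear B -> C}) :=
  lin (copair_linear f g).

(** Factorizations of linear maps require choosing preimages; a linear
    relation that is total and single-valued at 0 is the graph of a linear
    map, whatever the choices. *)
Lemma graph_linear A B (G : A -> B -> Prop) :
  (forall a, exists b, G a b) -> (forall b, G 0 b -> b = 0) ->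
  (forall s a b a' b', G a b -> G a' b' -> G (s *: a + a') (s *: b + b')) ->
  exists h : {linear A -> B}, forall a, G a (h a).
Proof.
move=> Gtot G0 Glin; pose h a := projT1 (cid (Gtot a)).
have hG a : G a (h a) by exact: projT2 (cid (Gtot a)).
have GN a b : G a b -> G (- a) (- b).
  move=> Gab; have G00 : G 0 0.
    by have [b0 Gb0] := Gtot 0; move: (Gb0); rewrite (G0 _ Gb0).
  by have := Glin (-1) _ _ _ _ Gab G00; rewrite !scaleN1r !addr0.
have Guniq a b b' : G a b -> G a b' -> b = b'.
  move=> Gab Gab'; apply/eqP; rewrite -subr_eq0; apply/eqP/G0.
  by have := Glin 1 _ _ _ _ Gab (GN _ _ Gab'); rewrite !scale1r subrr.
have hl : linear h by move=> s u v; apply: Guniq (hG _) _; apply: Glin.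
by exists (lin hl) => a; exact: hG.
Qed.

Lemma factor_through_surj A B C (s : {linear A -> B}) (w : {linear A -> C}) :
  surjection s -> (forall a, s a = 0 -> w a = 0) ->
  exists v : {linear B -> C}, forall a, v (s a) = w a.
Proof.
move=> s_surj sw.
have [|c|t a b a' b'|v vG] := @graph_linear B C (fun b c => exists2 a, s a = b & w a = c).
- by move=> b; have [a <-] := s_surj b; exists (w a), a.
- by case=> a sa <-; exact: sw.
- by case=> x <- <- [y <- <-]; exists (t *: x + y); rewrite linearP.
exists v => a; have [a' sa' <-] := vG (s a).
by apply/eqP; rewrite -subr_eq0 -linearB sw // linearB sa' subrr.
Qed.

Lemma factor_through_inj A B C (i : {linear B -> C}) (w : {linear A -> C}) :
  injective i -> (forall a, exists b, i b = w a) ->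
  exists v : {linear A -> B}, forall a, i (v a) = w a.
Proof.
move=> i_inj iw.
have [||s a b a' b' e e'|v vG] := @graph_linear A B (fun a b => i b = w a).
- exact: iw.
- by move=> b; rewrite linear0 => ib; apply: i_inj; rewrite linear0.
- by rewrite !linearP e e'.
by exists v.
Qed.

Lemma inj_ker0 A B (f : {linear A -> B}) :
  (forall a, f a = 0 -> a = 0) -> injective f.
Proof.
by move=> f0 a b fab; apply/eqP; rewrite -subr_eq0 (f0 (a - b)) // linearB fab subrr.
Qed.

Lemma ker0_inj A B (f : {linear A -> B}) a : injective f -> f a = 0 -> a = 0.
Proof. by move=> fI fa; apply: fI; rewrite linear0. Qed.

Lemma inj_surj_bij A B (f : {linear A -> B}) :
  injective f -> surjection f -> bijective f.
Proof.
move=> fI fS; exists (fun b => projT1 (cid (fS b))) => [a|b].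
  by apply: fI; exact: projT2 (cid (fS (f a))).
exact: projT2 (cid (fS b)).
Qed.

Lemma exact_comp0 A B C (f : {linear A -> B}) (g : {linear B -> C}) a :
  exact f g -> g (f a) = 0.
Proof. by move=> ex; apply/ex; exists a. Qed.

Lemma kernel_inclP A B (f : {linear A -> B}) a :
  f a = 0 <-> exists k, kernel_incl f k = a.
Proof.
split=> [fa|[k <-]]; last exact/eqP/(valP k).
by exists (Sub a (introT eqP fa)); exact: SubK.
Qed.

Lemma kernel_incl0 A B (f : {linear A -> B}) k : f (kernel_incl f k) = 0.
Proof. by apply/kernel_inclP; exists k. Qed.

Lemma kernel_incl_inj A B (f : {linear A -> B}) : injective (kernel_incl f).
Proof. exact: val_inj. Qed.

Lemma kernel_ses A B (f : {linear A -> B}) :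
  surjection f -> short_exact (kernel_incl f) f.
Proof. by split; [exact: kernel_incl_inj | exact: kernel_inclP | ]. Qed.

Lemma coker_proj0 A B (f : {linear A -> B}) b :
  coker_proj f b = 0 <-> exists a, f a = b.
Proof.
rewrite -[0](linear0 (coker_proj f : {linear B -> cokernel f})).
by rewrite coker_projP; split=> -[a fa]; exists a; rewrite ?subr0 // fa subr0.
Qed.

Lemma cokernel_ses A B (f : {linear A -> B}) :
  injective f -> short_exact f (coker_proj f : {linear B -> cokernel f}).
Proof. by split; [ | exact: coker_proj0 | exact: coker_proj_surj]. Qed.

(** The kernel term is written second so that the module to be recognized as a
    direct summand is the first factor. *)
Lemma short_exact_split A B C (f : {linear A -> B}) (g : {linear B -> C})
    (s : {linear C -> B}) :
  short_exact f g -> (forall c, g (s c) = c) ->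
  exists h : {linear (C * A)%type -> B}, bijective h.
Proof.
move=> [fI fg gS] gs; exists (copair s f).
have [r rE] : exists r : {linear B -> A}, forall b, f (r b) = b - s (g b).
  have dl : linear (fun b => b - s (g b)).
    by move=> a u v; rewrite !linearP scalerDr addrACA.
  apply: (@factor_through_inj _ _ _ f (lin dl)) => // b; apply/fg.
  by rewrite /= linearB gs subrr.
exists (fun b => (g b, r b)) => [[c a]|b] /=; last by rewrite rE addrC subrK.
have gE : g (s c + f a) = c by rewrite linearD gs (exact_comp0 a fg) addr0.
by congr pair => //; apply: fI; rewrite rE gE addrC addKr.
Qed.

Lemma projective_split A B C (f : {linear A -> B}) (g : {linear B -> C}) :
  projective C -> short_exact f g ->
  exists s : {linear C -> B}, forall c, g (s c) = c.
Proof.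
move=> pC [_ _ gS].
exact: (pC _ _ g (idfun : {linear C -> C}) gS).
Qed.

Lemma trivial_projective Z : trivial_module Z -> projective Z.
Proof.
move=> Z0 A B f g _; exists (\0 : {linear Z -> A}) => x.
by rewrite (Z0 x) !linear0.
Qed.

Lemma projective_retract K E P (f : {linear K -> E}) (g : {linear E -> P}) :
  projective P -> short_exact f g -> exists r : {linear E -> K}, forall x, r (f x) = x.
Proof.
move=> pP fg; have [s sE] := projective_split pP fg.
have [fI fgE gS] := fg.
have [|r rE] := factor_through_inj (w := idfun \- (s \o g) : {linear _ -> _}) fI.
  by move=> x; apply/fgE; rewrite /= linearB sE subrr.
exists r => x; apply: fI.
by rewrite rE /= (exact_comp0 _ fgE) linear0 subr0.
Qed.

Lemma projective_kernel K Q P (k : {linear K -> Q}) (q : {linear Q -> P}) :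
  projective P -> projective Q -> short_exact k q -> projective K.
Proof.
move=> pP pQ kq A B f g fS; have [r rE] := projective_retract pP kq.
have [h hE] := pQ _ _ f (g \o r : {linear _ -> _}) fS.
by exists (h \o k : {linear _ -> _}) => x; rewrite /= hE /= rE.
Qed.

Lemma projective_prod P Q : projective P -> projective Q ->
  projective (P * Q)%type.
Proof.
move=> pP pQ A B f g fS.
have [h1 h1E] := pP _ _ f (g \o prod_inl P Q : {linear _ -> _}) fS.
have [h2 h2E] := pQ _ _ f (g \o prod_inr P Q : {linear _ -> _}) fS.
exists (copair h1 h2) => -[x y] /=; rewrite linearD h1E h2E /= -linearD.
by congr (g _); congr pair; rewrite /= ?addr0 ?add0r.
Qed.

Lemma exists_projective_cover A :
  exists (K P : lmodType S) (k : {linear K -> P}) (p : {linear P -> A}),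
    projective P /\ short_exact k p.
Proof.
exists (kernel (free_cover A)), (freemod S A), (kernel_incl _), (free_cover A).
split; first exact: free_projective.
by apply: kernel_ses; exact: free_cover_surj.
Qed.

End LinearMaps.

(** * Vanishing of Ext along short exact sequences *)

Arguments aug_surj {S A} r b.
Arguments aug_exact {S A} r b.
Arguments diff_exact {S A} r i b.

Section Splice.
Variables (S : pzRingType) (K P A : lmodType S).
Variables (k : {linear K -> P}) (p : {linear P -> A}) (kp : short_exact k p).
Variable (Q : resolution K).

(** Splicing $0 \to K \to P \to A \to 0$ with a resolution of $K$ gives a
    resolution of $A$; with truncation below it turns degree $i+1$ over $A$
    into degree $i$ over $K$. *)
Definition splice_term i : lmodType S := if i is j.+1 then term Q j else P.

Definition splice_diff i : {linear splice_term i.+1 -> splice_term i} :=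
  match i with 0 => k \o aug Q : {linear _ -> _} | j.+1 => diff Q j end.

Lemma splice_exact0 : exact (splice_diff 0) p.
Proof.
have [_ kpE _] := kp => b; rewrite kpE; split=> -[a <-] /=.
  by have [q <-] := aug_surj Q a; exists q.
by exists (aug Q a).
Qed.

Lemma splice_exactS i : exact (splice_diff i.+1) (splice_diff i).
Proof.
case: i => [|i]; last exact: diff_exact.
have [kI _ _] := kp => b /=; rewrite -(aug_exact Q).
by split=> [/(ker0_inj kI)|->] //; rewrite linear0.
Qed.

Lemma splice_aug_surj : surjection p.
Proof. by case: kp. Qed.

Definition splice : resolution A :=
  Resolution splice_aug_surj splice_exact0 splice_exactS.

Lemma splice_projective :
  projective P -> projective_resolution Q -> projective_resolution splice.
Proof. by move=> pP pQ [|i] //=; exact: pQ. Qed.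

End Splice.

Section Truncate.
Variables (S : pzRingType) (A : lmodType S) (P : resolution A).
Variables (K : lmodType S) (k : {linear K -> term P 0}) (kp : short_exact k (aug P)).

Lemma truncate_aug : exists e : {linear term P 1 -> K}, forall x, k (e x) = diff P 0 x.
Proof.
have [kI kpE _] := kp; apply: (factor_through_inj (w := diff P 0) kI) => x; apply/kpE.
by apply/aug_exact; exists x.
Qed.

Variable (e : {linear term P 1 -> K}).
Hypothesis eE : forall x, k (e x) = diff P 0 x.

Lemma truncate_surj : surjection e.
Proof.
have [kI kpE _] := kp => a.
have /aug_exact[x dx] : aug P (k a) = 0 by exact: exact_comp0.
by exists x; apply: kI; rewrite eE.
Qed.

Lemma truncate_exact0 : exact (diff P 1) e.
Proof.
have [kI _ _] := kp => b; rewrite -(diff_exact P 0) -eE.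
by split=> [->|/(ker0_inj kI)] //; rewrite linear0.
Qed.

Definition truncate : resolution K :=
  @Resolution S K (fun i => term P i.+1) (fun i => diff P i.+1) e
    truncate_surj truncate_exact0 (fun i => diff_exact P i.+1).

Lemma truncate_projective :
  projective_resolution P -> projective_resolution truncate.
Proof. by move=> pP i; exact: pP. Qed.

End Truncate.

Section Ext.
Variable S : pzRingType.
Implicit Types A B C D E K L P Q W X Y Z : lmodType S.

(** A one-cocycle on a resolution of $A$ is a linear map on the first syzygy. *)
Lemma Ext_zero1_proj A B :
  (forall K P (f : {linear K -> P}) (g : {linear P -> A}), projective P ->
     short_exact f g ->
     forall u : {linear K -> B}, exists v : {linear P -> B}, forall x, v (f x) = u x) ->
  Ext_zero 1 A B.
Proof.
move=> ext P pP f fd.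
have kp := kernel_ses (aug_surj P).
have [e eE] := truncate_aug kp.
have [|u uE] := factor_through_surj (truncate_surj kp eE) (w := f).
  by move=> x /(truncate_exact0 kp eE)[y <-]; exact: fd.
have [v vE] := ext _ _ _ _ (pP 0) kp u.
by exists v => x; rewrite -eE vE uE.
Qed.

(** The map $v$ is defined on $E$ through the surjection from $P_0 \times K$
    onto it, where $P_0$ covers $A$: on $K$ it must be $u$, and on $P_0$ it is
    the map whose coboundary is the cocycle induced by $u$. *)
Lemma Ext_zero1P A B : Ext_zero 1 A B <->
  forall K E (f : {linear K -> E}) (g : {linear E -> A}), short_exact f g ->
  forall u : {linear K -> B}, exists v : {linear E -> B}, forall x, v (f x) = u x.
Proof.
split=> [extA K E f g [fI fg gS] u|ext]; last first.
  by apply: Ext_zero1_proj => K P f g _; exact: ext.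
have [P pP] := exists_projective_resolution A.
have [h hE] := pP 0 _ _ g (aug P) gS.
have hd_in x : exists y, f y = h (diff P 0 x).
  by apply/fg; rewrite hE; apply/aug_exact; exists x.
have [k kE] := @factor_through_inj _ _ _ _ f (h \o diff P 0 : {linear _ -> _}) fI hd_in.
have [|w wE] := extA P pP (u \o k : {linear _ -> _}).
  move=> x; rewrite /= -[RHS](linear0 u); congr (u _); apply: fI.
  by rewrite kE /= (exact_comp0 _ (diff_exact P 0)) !linear0.
have [||v vE] := @factor_through_surj _ _ _ _ (copair h f) (copair w u).
- move=> e; have [p pE] := aug_surj P (g e).
  have /fg[y yE] : g (e - h p) = 0 by rewrite linearB hE pE subrr.
  by exists (p, y); rewrite /= yE addrC subrK.
- case=> p y /= hfpy.
  have /aug_exact[q qE] : aug P p = 0.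
    by rewrite -hE -[RHS](linear0 g) -hfpy linearD (exact_comp0 _ fg) addr0.
  have -> : y = - k q.
    apply: fI; rewrite linearN kE /= qE; apply/eqP; rewrite -addr_eq0 addrC.
    exact/eqP.
  by rewrite -qE -wE linearN /= subrr.
exists v => x; have := vE (0, x).
by rewrite /= !linear0 !add0r.
Qed.

(** Quantifying over all presentations of $A$ matches the quantification over
    all projective resolutions in [Ext_zero], and takes the place of a
    comparison of resolutions. *)
Lemma Ext_zeroSSP i A B : Ext_zero i.+2 A B <->
  forall K P (k : {linear K -> P}) (p : {linear P -> A}),
    projective P -> short_exact k p -> Ext_zero i.+1 K B.
Proof.
split=> [ext K P k p pP kp Q pQ f fd|ext P pP f fd].
  exact: (ext (splice kp Q) (splice_projective pP pQ) f fd).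
have kp := kernel_ses (aug_surj P).
have [e eE] := truncate_aug kp.
exact: (ext _ _ _ _ (pP 0%N) kp (truncate kp eE) (truncate_projective pP) f fd).
Qed.

Lemma Ext_zero_trivial i A B : trivial_module B -> Ext_zero i.+1 A B.
Proof. by move=> B0 P pP f fd; exists (\0 : {linear _ -> _}) => x; rewrite [LHS]B0. Qed.

(** From the long exact sequence $\mathrm{Ext}^{i+1}(X, D) \to
    \mathrm{Ext}^{i+1}(X, K) \to \mathrm{Ext}^{i+2}(X, L)$, chased on cocycles
    of a single projective resolution of $X$. *)
Lemma Ext_zero_quotient i X K D L (f : {linear L -> D}) (g : {linear D -> K}) :
  short_exact f g -> Ext_zero i.+1 X D -> Ext_zero i.+2 X L -> Ext_zero i.+1 X K.
Proof.
move=> [fI fg gS] extD extL P pP u ud.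
have [u' u'E] := pP i.+1 _ _ g u gS.
have ud_in x : exists y, f y = u' (diff P i.+1 x).
  by apply/fg; rewrite u'E ud.
have [c cE] := @factor_through_inj _ _ _ _ f (u' \o diff P i.+1 : {linear _ -> _}) fI ud_in.
have [|w wE] := extL P pP c.
  move=> x; apply: (ker0_inj fI); rewrite cE /=.
  by rewrite (exact_comp0 _ (diff_exact P i.+1)) linear0.
have [|h hE] := extD P pP (u' \- (f \o w) : {linear _ -> _}).
  by move=> x; rewrite /= -wE cE subrr.
exists (g \o h : {linear _ -> _}) => x.
by rewrite /= -hE /= linearB u'E (exact_comp0 _ fg) subr0.
Qed.

(** Lifting $Q_0 \to L$ to $X$ makes $P_0 \times Q_0$ a cover of $X$. The last
    equation lets a map on $P_0 \times Q_0$ be restricted to $W_1 \subset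
    P_0$. *)
Lemma horseshoe W X L (f : {linear W -> X}) (g : {linear X -> L})
    (W1 P0 : lmodType S) (w1 : {linear W1 -> P0}) (w0 : {linear P0 -> W})
    (L1 Q0 : lmodType S) (l1 : {linear L1 -> Q0}) (l0 : {linear Q0 -> L}) :
  short_exact f g -> short_exact w1 w0 -> projective Q0 -> short_exact l1 l0 ->
  exists X1 (x1 : {linear X1 -> (P0 * Q0)%type}) (x0 : {linear (P0 * Q0)%type -> X})
     (a : {linear W1 -> X1}) (b : {linear X1 -> L1}),
    [/\ short_exact x1 x0, short_exact a b & forall w, x1 (a w) = (w1 w, 0)].
Proof.
move=> [fI fg gS] [w1I w1w0 w0S] pQ0 [l1I l1l0 l0S].
have [h hE] := pQ0 _ _ g l0 gS.
pose x0 := copair (f \o w0 : {linear _ -> _}) h.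
have x0S : surjection x0.
  move=> x; have [q qE] := l0S (g x).
  have /fg[w wE] : g (x - h q) = 0 by rewrite linearB hE qE subrr.
  by have [p pE] := w0S w; exists (p, q); rewrite /x0 /= pE wE subrK.
have x0ses := kernel_ses x0S; have [x1I x1x0 _] := x0ses.
exists (kernel x0), (kernel_incl x0), x0.
have [|a aE] := factor_through_inj (w := prod_inl P0 Q0 \o w1 : {linear _ -> _}) x1I.
  move=> w; apply/x1x0.
  by rewrite /x0 /= (exact_comp0 _ w1w0) !linear0 addr0.
have sl : linear (fun z : kernel x0 => (kernel_incl x0 z).2).
  by move=> s x y; rewrite linearP.
have [|b bE] := factor_through_inj (w := lin sl) l1I.
  move=> z; apply/l1l0; rewrite /= -hE.
  have := kernel_incl0 z; rewrite {1}/x0 /= => /(congr1 g).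
  by rewrite linear0 linearD (exact_comp0 _ fg) add0r.
exists a, b; split=> //; split.
- move=> u v uv; apply: w1I.
  by have := congr1 (kernel_incl x0) uv; rewrite !aE /= => -[].
- move=> z; split=> [bz|[w <-]]; last by apply: l1I; rewrite bE linear0; exact: (congr1 snd (aE w)).
  have zE : (kernel_incl x0 z).2 = 0 by have := bE z; rewrite bz linear0 => /esym.
  have /w1w0[w wE] : w0 (kernel_incl x0 z).1 = 0.
    apply: (ker0_inj fI); have := kernel_incl0 z; rewrite {1}/x0 /= zE linear0.
    by rewrite addr0.
  by exists w; apply: x1I; rewrite aE [RHS]surjective_pairing zE -wE.
- move=> y.
  have /fg[w wE] : g (h (l1 y)) = 0 by rewrite hE (exact_comp0 _ l1l0).
  have [p pE] := w0S (- w).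
  have /x1x0[z zE] : x0 (p, l1 y) = 0.
    by rewrite /x0 /= pE -wE linearN addNr.
  by exists z; apply: l1I; rewrite bE; exact: (congr1 snd zE).
Qed.

(** From the long exact sequence $\mathrm{Ext}^{i+1}(X, Y) \to
    \mathrm{Ext}^{i+1}(W, Y) \to \mathrm{Ext}^{i+2}(L, Y)$. The horseshoe
    replaces $W$, $X$, $L$ by their syzygies and lowers the degree by one; in
    degree one, a map on the syzygy of $W$ extends to the syzygy of $X$
    because $\mathrm{Ext}^1$ of the syzygy of $L$ vanishes, and then to $P_0
    \times Q_0$ because $\mathrm{Ext}^1(X, Y) = 0$. *)
Lemma Ext_zero_sub i W X L Y (f : {linear W -> X}) (g : {linear X -> L}) :
  short_exact f g -> Ext_zero i.+1 X Y -> Ext_zero i.+2 L Y -> Ext_zero i.+1 W Y.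
Proof.
have [L1 [Q0 [l1 [l0 [pQ0 l1l0]]]]] := exists_projective_cover L.
elim: i W X L f g L1 Q0 l1 l0 pQ0 l1l0 => [|i IH] W X L f g L1 Q0 l1 l0 pQ0 l1l0 fg extX /Ext_zeroSSP extL.
  apply: Ext_zero1_proj => W1 P0 w1 w0 pP0 w1w0 u.
  have [X1 [x1 [x0 [a [b [x1x0 ab abE]]]]]] := horseshoe fg w1w0 pQ0 l1l0.
  have [u1 u1E] := (Ext_zero1P _ _).1 (extL _ _ _ _ pQ0 l1l0) _ _ _ _ ab u.
  have [v vE] := (Ext_zero1P _ _).1 extX _ _ _ _ x1x0 u1.
  by exists (v \o prod_inl P0 Q0 : {linear _ -> _}) => x; rewrite /= -abE vE u1E.
apply/Ext_zeroSSP => W1 P0 w1 w0 pP0 w1w0.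
have [X1 [x1 [x0 [a [b [x1x0 ab _]]]]]] := horseshoe fg w1w0 pQ0 l1l0.
have [L2 [Q1 [l2 [l3 [pQ1 l2l3]]]]] := exists_projective_cover L1.
apply: (IH _ _ _ _ _ _ _ _ _ pQ1 l2l3 ab); last exact: extL pQ0 l1l0.
exact: (Ext_zeroSSP _ _ _).1 extX _ _ _ _ (projective_prod pP0 pQ0) x1x0.
Qed.


Lemma Ext_zero_projective i P B : projective P -> Ext_zero i.+1 P B.
Proof.
elim: i P => [|i IH] P pP.
  apply/Ext_zero1P => K E f g fg u; have [r rE] := projective_retract pP fg.
  by exists (u \o r : {linear _ -> _}) => x /=; rewrite rE.
apply/Ext_zeroSSP => K Q k q pQ kq; apply: IH; exact: projective_kernel kq.
Qed.

(** The pullback of the extension along $u$ is an extension of $X$ by $L$,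
    hence has a retraction onto $L$. *)
Lemma Ext_zero1_lift X L E A (f : {linear L -> E}) (g : {linear E -> A})
    (u : {linear X -> A}) :
  short_exact f g -> Ext_zero 1 X L ->
  exists v : {linear X -> E}, forall x, g (v x) = u x.
Proof.
move=> [fI fg gS] /Ext_zero1P ext.
(* The kernel of $q : (e, x) \mapsto g(e) - u(x)$ is the pullback. *)
pose q := copair g (\- u : {linear _ -> _}).
have kerq z : g (kernel_incl q z).1 = u (kernel_incl q z).2.
  by have := kernel_incl0 z; rewrite {1}/q /= => /eqP; rewrite subr_eq0 => /eqP.
have [|a aE] := factor_through_inj (w := prod_inl E X \o f : {linear _ -> _}) (@kernel_incl_inj _ _ _ q).
  by move=> l; apply/kernel_inclP; rewrite /q /= linear0 oppr0 addr0 (exact_comp0 _ fg).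
have bl : linear (fun z : kernel q => (kernel_incl q z).2) by move=> s x y; rewrite linearP.
have cl : linear (fun z : kernel q => (kernel_incl q z).1) by move=> s x y; rewrite linearP.
have bS : surjection (lin bl).
  move=> x; have [e eE] := gS (u x).
  have /kernel_inclP[z zE] : q (e, x) = 0 by rewrite /q /= eE subrr.
  by exists z; exact: (congr1 snd zE).
have ab : short_exact a (lin bl).
  split=> // [l l' ll'|z].
    by apply: fI; have := congr1 (kernel_incl q) ll'; rewrite !aE => -[].
  split=> [z2|[l <-]]; last exact: (congr1 snd (aE l)).
  have z2' : (kernel_incl q z).2 = 0 by exact: z2.
  have /fg[l lE] : g (kernel_incl q z).1 = 0 by rewrite kerq z2' linear0.
  exists l; apply: kernel_incl_inj.
  by rewrite aE [RHS]surjective_pairing z2' -lE.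
have [r rE] := ext _ _ _ _ ab (idfun : {linear L -> L}).
have [|v vE] := factor_through_surj (s := lin bl) (w := lin cl \- (f \o r) : {linear _ -> _}) bS.
  move=> z; have [_ abE _] := ab; move/abE => [l <-].
  apply/eqP; rewrite subr_eq0; apply/eqP; rewrite [RHS]/= rE.
  exact: (congr1 fst (aE l)).
exists v => x; have [z zE] := bS x; rewrite -zE vE /= linearB (exact_comp0 _ fg) subr0.
exact: kerq.
Qed.

(** Degree shifting in the second variable without injective modules. A
    cocycle $f : P_{i+2} \to Y$ dies in the pushout $E$ of $f$ and the
    differential $P_{i+2} \to P_{i+1}$, which contains $Y$; if $E$ embeds into
    $Y'$ with $\mathrm{Ext}^{i+1}(X, Y'/Y) = 0$, the class of $f$, which comes
    from that group, is zero. *)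
Lemma Ext_zeroSS_embed i X Y :
  (forall E (u : {linear Y -> E}), injective u ->
     exists Y' L (v : {linear E -> Y'}) (p : {linear Y' -> L}),
       short_exact (v \o u : {linear Y -> Y'}) p /\ Ext_zero i.+1 X L) ->
  Ext_zero i.+2 X Y.
Proof.
move=> emb P pP f fd.
(* The cokernel of this map is the pushout $E$. *)
have al : linear (fun p => (f p, - diff P i.+1 p) : (Y * term P i.+1)%type).
  by move=> s x y; rewrite !linearP.
pose a := lin al; pose c : {linear (Y * term P i.+1)%type -> cokernel a} := coker_proj a.
have [|Y' [L [v [p [[vuI vup pS] extL]]]]] := emb _ (c \o prod_inl _ _ : {linear _ -> _}).
  apply: inj_ker0 => y /coker_proj0 [x [fx /eqP]].
  by rewrite oppr_eq0 => /eqP /diff_exact[z zx]; rewrite -fx -zx fd.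
have [h hd] : exists h : {linear term P i.+1 -> Y'},
    forall x, h (diff P i.+1 x) = v (c (f x, 0)).
  exists (v \o (c \o prod_inr _ _) : {linear _ -> _}) => x; congr (v _); apply/coker_projP; exists (- x).
  by congr pair; rewrite /= linearN ?opprK ?sub0r ?subr0.
have [|g gE] := extL P pP (p \o h : {linear _ -> _}).
  by move=> x; rewrite /= hd; exact: (exact_comp0 (f x) vup).
have [g' g'E] := pP i _ _ p g pS.
have [|k kE] := factor_through_inj (w := h \- (g' \o diff P i) : {linear _ -> _}) vuI.
  by move=> x; apply/vup; rewrite /= linearB g'E -gE /= subrr.
exists k => x; apply: vuI; rewrite kE /= hd.
by rewrite (exact_comp0 _ (diff_exact P i)) linear0 subr0.
Qed.

End Ext.

(** * Finite resolutions and cotorsion pairs *)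

Section FiniteResolutions.
Variable S : pzRingType.
Variable C : modclass S.

(** If $0 \in \mathcal C$, this is the class $\mathcal C_m^\wedge$ at level $m
    + 1$: resolutions with at most $m + 1$ nonzero terms. Counting terms
    instead of the top index makes the zero module a base case that involves
    no member of $\mathcal C$. *)
Inductive finite_res : nat -> modclass S :=
| FiniteResTrivial m A : trivial_module A -> finite_res m A
| FiniteResCons m (L X A : lmodType S) (f : {linear L -> X}) (g : {linear X -> A}) :
    short_exact f g -> C X -> finite_res m L -> finite_res m.+1 A.

(** If $0 \in \mathcal C$, this is the class $\mathcal C_m^\vee$ at level $m +
    1$. *)
Inductive finite_cores : nat -> modclass S :=
| FiniteCoresTrivial m A : trivial_module A -> finite_cores m A
| FiniteCoresCons m (A X L : lmodType S) (f : {linear A -> X}) (g : {linear X -> L}) :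
    short_exact f g -> C X -> finite_cores m L -> finite_cores m.+1 A.

Hypothesis C0 : forall Z : lmodType S, trivial_module Z -> C Z.

Lemma trivial_resolution (A : lmodType S) : trivial_module A ->
  exists X : resolution A, forall i, trivial_module (term X i).
Proof.
move=> A0; pose z : {linear A -> A} := \0.
have zS : surjection z by move=> a; exists a; rewrite [RHS]A0.
have zz : exact z z by move=> a; split=> // _; exists a; rewrite [RHS]A0.
by exists (@Resolution S A (fun=> A) (fun=> z) z zS zz (fun=> zz)).
Qed.

Lemma wedgeP m A : wedge C m A <-> finite_res m.+1 A.
Proof.
split=> [[k [X]]|].
  elim: k m A X => [|k IH] m A X [km XC X0].
    apply: (FiniteResCons (kernel_ses (aug_surj X)) (XC 0%N isT)).
    have [e eE] := truncate_aug (kernel_ses (aug_surj X)).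
    apply: FiniteResTrivial => z.
    have [x <-] := truncate_surj (kernel_ses (aug_surj X)) eE z.
    by rewrite (X0 1%N isT x) linear0.
  case: m km => // m km.
  apply: (FiniteResCons (kernel_ses (aug_surj X)) (XC 0%N isT)).
  have [e eE] := truncate_aug (kernel_ses (aug_surj X)).
  apply: (IH _ _ (truncate (kernel_ses (aug_surj X)) eE)); split=> // i ik.
    exact: XC.
  exact: X0.
have fin j B : finite_res j B -> exists k (X : resolution B),
    [/\ (k <= j)%N, forall i, (i < k)%N -> C (term X i) &
      forall i, (k <= i)%N -> trivial_module (term X i)].
  elim=> {j B} [j B B0|j L X B f g fg CX _ [k [Y [kj YC Y0]]]].
    by have [X X0] := trivial_resolution B0; exists 0%N, X; split=> // i _; exact: X0.
  exists k.+1, (splice fg Y); split=> // [] [|i] //= ik; first exact: YC.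
  exact: Y0.
move=> /fin [[|k] [X [km XC X0]]]; last by exists k, X; split.
exists 0%N, X; split=> // i; last by move=> /ltnW; exact: X0.
by move=> _; apply: C0; exact: X0.
Qed.

End FiniteResolutions.

Section Cosplice.
Variables (S : pzRingType) (A X L : lmodType S).
Variables (f : {linear A -> X}) (g : {linear X -> L}) (fg : short_exact f g).
Variable (Q : coresolution L).

Definition cosplice_term i : lmodType S := if i is j.+1 then coterm Q j else X.

Definition cosplice_diff i : {linear cosplice_term i -> cosplice_term i.+1} :=
  match i with 0 => coaug Q \o g : {linear _ -> _} | j.+1 => codiff Q j end.

Lemma cosplice_exact0 : exact f (cosplice_diff 0).
Proof.
have [_ fgE _] := fg => b; rewrite -fgE /=.
by split=> [/(ker0_inj (@coaug_inj _ _ Q))|->] //; rewrite linear0.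
Qed.

Lemma cosplice_exactS i : exact (cosplice_diff i) (cosplice_diff i.+1).
Proof.
case: i => [|i]; last exact: codiff_exact.
have [_ _ gS] := fg => b /=; rewrite (@coaug_exact _ _ Q b).
split=> -[a <-]; first by have [x <-] := gS a; exists x.
by exists (g a).
Qed.

Lemma cosplice_coaug_inj : injective f.
Proof. by case: fg. Qed.

Definition cosplice : coresolution A :=
  Coresolution cosplice_coaug_inj cosplice_exact0 cosplice_exactS.

End Cosplice.

Section Cotruncate.
Variables (S : pzRingType) (A : lmodType S) (X : coresolution A).
Local Notation L := (cokernel (coaug X)).
Let p : {linear coterm X 0 -> L} := coker_proj (coaug X).

Lemma cotruncate_coaug :
  exists e : {linear L -> coterm X 1}, forall x, e (p x) = codiff X 0 x.
Proof.
apply: (factor_through_surj (s := p) (w := codiff X 0)); first exact: coker_proj_surj.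
by move=> x /coker_proj0/coaug_exact.
Qed.

Variable e : {linear L -> coterm X 1}.
Hypothesis eE : forall x, e (p x) = codiff X 0 x.

Lemma cotruncate_inj : injective e.
Proof.
apply: inj_ker0 => y; have [x <-] := coker_proj_surj y.
by rewrite eE => /coaug_exact/coker_proj0.
Qed.

Lemma cotruncate_exact0 : exact e (codiff X 1).
Proof.
move=> b; rewrite (@codiff_exact _ _ X 0 b); split=> -[a <-].
  by exists (p a).
by have [x <-] := coker_proj_surj a; exists x; rewrite eE.
Qed.

Definition cotruncate : coresolution L :=
  @Coresolution S L (fun i => coterm X i.+1) (fun i => codiff X i.+1) e
    cotruncate_inj cotruncate_exact0 (fun i => @codiff_exact _ _ X i.+1).

End Cotruncate.

Section FiniteCoresolutions.
Variables (S : pzRingType) (C : modclass S).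
Hypothesis C0 : forall Z : lmodType S, trivial_module Z -> C Z.

Lemma trivial_coresolution (A : lmodType S) : trivial_module A ->
  exists X : coresolution A, forall i, trivial_module (coterm X i).
Proof.
move=> A0; pose z : {linear A -> A} := \0.
have zI : injective z by move=> a b _; rewrite (A0 a) (A0 b).
have zz : exact z z by move=> a; split=> // _; exists a; rewrite [RHS]A0.
by exists (@Coresolution S A (fun=> A) (fun=> z) z zI zz (fun=> zz)).
Qed.

Lemma veeP m A : vee C m A <-> finite_cores C m.+1 A.
Proof.
split=> [[k [X]]|].
  elim: k m A X => [|k IH] m A X [km XC X0].
    apply: (FiniteCoresCons (cokernel_ses (@coaug_inj _ _ X)) (XC 0%N isT)).
    have [e eE] := cotruncate_coaug X.
    apply: FiniteCoresTrivial => z; apply: (cotruncate_inj eE).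
    by rewrite (X0 1%N isT (e z)) linear0.
  case: m km => // m km.
  apply: (FiniteCoresCons (cokernel_ses (@coaug_inj _ _ X)) (XC 0%N isT)).
  have [e eE] := cotruncate_coaug X.
  apply: (IH _ _ (cotruncate eE)); split=> // i ik; first exact: XC.
  exact: X0.
have fin j B : finite_cores C j B -> exists k (X : coresolution B),
    [/\ (k <= j)%N, forall i, (i < k)%N -> C (coterm X i) &
      forall i, (k <= i)%N -> trivial_module (coterm X i)].
  elim=> {j B} [j B B0|j B X L f g fg CX _ [k [Y [kj YC Y0]]]].
    by have [X X0] := trivial_coresolution B0; exists 0%N, X; split=> // i _; exact: X0.
  exists k.+1, (cosplice fg Y); split=> // [] [|i] //= ik; first exact: YC.
  exact: Y0.
move=> /fin [[|k] [X [km XC X0]]]; last by exists k, X; split.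
exists 0%N, X; split=> // i; last by move=> /ltnW; exact: X0.
by move=> _; apply: C0; exact: X0.
Qed.

End FiniteCoresolutions.

Section CotorsionPairs.
Variables (S : pzRingType) (n : nat) (C D : modclass S).

Lemma Ext_zero_finite_res X m W i :
  (forall j Y, (1 <= j <= n)%N -> D Y -> Ext_zero j X Y) ->
  finite_res D m W -> (i + m <= n)%N -> Ext_zero i.+1 X W.
Proof.
move=> ext resW; elim: resW i => {m W} [m W W0|m L Y W f g fg DY _ IH] i im.
  exact: Ext_zero_trivial.
apply: (Ext_zero_quotient fg); last by apply: IH; rewrite addSnnS.
by apply: ext => //=; apply: leq_trans im; rewrite addnS ltnS leq_addr.
Qed.

Lemma Ext_zero_finite_cores Y m W i :
  (forall j X, (1 <= j <= n)%N -> C X -> Ext_zero j X Y) ->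
  finite_cores C m W -> (i + m <= n)%N -> Ext_zero i.+1 W Y.
Proof.
move=> ext resW; elim: resW i => {m W} [m W W0|m W X L f g fg CX _ IH] i im.
  exact/Ext_zero_projective/trivial_projective.
apply: (Ext_zero_sub fg); last by apply: IH; rewrite addSnnS.
by apply: ext => //=; apply: leq_trans im; rewrite addnS ltnS leq_addr.
Qed.

Hypothesis n_gt0 : (0 < n)%N.

(** The approximation $0 \to K \to X' \to X \to 0$ splits: $\mathrm{Ext}^1(X,
    K)$ vanishes by dimension shifting along the finite resolution of $K$. *)
Lemma left_cotorsion_mem X :
  (forall Z : lmodType S, trivial_module Z -> D Z) ->
  left_cotorsion_pair n C D ->
  (forall i Y, (1 <= i <= n)%N -> D Y -> Ext_zero i X Y) -> C X.
Proof.
move=> D0 [Csum _ Ccov] ext; have [K [X' [f [g [fg CX' /(wedgeP D0)]]]]] := Ccov X.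
rewrite prednK // => resK.
have extK : Ext_zero 1 X K by apply: (Ext_zero_finite_res ext resK).
have [s sE] := Ext_zero1_lift (idfun : {linear X -> X}) fg extK.
have [h hB] := short_exact_split fg sE.
exact: Csum hB CX'.
Qed.

(** The approximation $0 \to Y \to Y' \to K \to 0$ splits: $\mathrm{Ext}^1(K,
    Y)$ vanishes by dimension shifting along the finite coresolution of $K$. *)
Lemma right_cotorsion_mem Y :
  (forall Z : lmodType S, trivial_module Z -> C Z) ->
  right_cotorsion_pair n C D ->
  (forall i X, (1 <= i <= n)%N -> C X -> Ext_zero i X Y) -> D Y.
Proof.
move=> C0 [Dsum _ Dcov] ext; have [Y' [K [f [g [fg DY' /(veeP C0)]]]]] := Dcov Y.
rewrite prednK // => resK.
have extK : Ext_zero 1 K Y by apply: (Ext_zero_finite_cores ext resK).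
have [r rE] := (Ext_zero1P _ _).1 extK _ _ _ _ fg (idfun : {linear Y -> Y}).
have [fI fgE gS] := fg.
have kS : surjection r by move=> y; exists (f y); rewrite rE.
have ses := kernel_ses kS.
have [h hB] := short_exact_split ses rE.
exact: Dsum hB DY'.
Qed.

(** $\mathrm{Ext}^i(K, D)$ lies between $\mathrm{Ext}^i(X, D)$ and
    $\mathrm{Ext}^{i+1}(A, D)$; for $i = n$ the latter is zero because the
    pair is hereditary. *)
Lemma left_closed_kernels (K X A : lmodType S) (f : {linear K -> X}) (g : {linear X -> A}) :
  (forall Z : lmodType S, trivial_module Z -> D Z) ->
  left_cotorsion_pair n C D -> hereditary n C D ->
  short_exact f g -> C X -> C A -> C K.
Proof.
move=> D0 CD her fg CX CA; apply: left_cotorsion_mem => // -[//|i] Y /=.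
have [_ ext _] := CD; rewrite leq_eqVlt => /orP[/eqP ein|i_lt] DY.
  apply: (Ext_zero_sub fg); first by apply: ext => //=; rewrite ein.
  by rewrite ein; exact: her.
by apply: (Ext_zero_sub fg); apply: ext => //=; exact: ltnW.
Qed.

(** $\mathrm{Ext}^i(C, L)$ lies between $\mathrm{Ext}^i(C, Y)$ and
    $\mathrm{Ext}^{i+1}(C, A)$; for $i = n$ the latter is zero because the
    pair is hereditary. *)
Lemma right_closed_cokernels (A Y L : lmodType S) (f : {linear A -> Y}) (g : {linear Y -> L}) :
  (forall Z : lmodType S, trivial_module Z -> C Z) ->
  right_cotorsion_pair n C D -> hereditary n C D ->
  short_exact f g -> D A -> D Y -> D L.
Proof.
move=> C0 CD her fg DA DY; apply: right_cotorsion_mem => // -[//|i] X /=.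
have [_ ext _] := CD; rewrite leq_eqVlt => /orP[/eqP ein|i_lt] CX.
  apply: (Ext_zero_quotient fg); first by apply: ext => //=; rewrite ein.
  by rewrite ein; exact: her.
by apply: (Ext_zero_quotient fg); apply: ext => //=; exact: ltnW.
Qed.

End CotorsionPairs.

(** * Modules over the trivial extension *)

Section TrivextModules.
Variables (R : pzRingType) (M : bimodType R).
Local Notation S := (trivext M).

Lemma trivext_split (t : S) : t = tinl M t.1 + tinr t.2.
Proof. by case: t => r m; congr pair; rewrite /= ?addr0 ?add0r. Qed.

Lemma trivext_scaleE (X : lmodType S) (t : S) (x : X) :
  t *: x = (t.1 *: (x : res X) : res X) + mact t.2 (x : res X).
Proof. by rewrite [in LHS](trivext_split t) scalerDl. Qed.

Lemma trivext_linear (X Y : lmodType S) (f : {linear res X -> res Y}) :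
  (forall m x, f (mact m x) = mact m (f x)) ->
  exists g : {linear X -> Y}, forall x, g x = f x.
Proof.
move=> fm; have fl : linear (f : X -> Y).
  move=> t x y; rewrite trivext_scaleE.
  rewrite [LHS](linearD f) [f (_ + _)](linearD f) fm.
  by rewrite (linearZ_LR f) trivext_scaleE.
by exists (lin fl).
Qed.

Lemma res_map_linear (X Y : lmodType S) (f : {linear X -> Y}) :
  linear (f : res X -> res Y).
Proof. by move=> r x y; exact: (linearP f). Qed.

Definition res_map X Y f : {linear res X -> res Y} := lin (@res_map_linear X Y f).

Lemma res_map_mact (X Y : lmodType S) (f : {linear X -> Y}) m x :
  res_map f (mact m x) = mact m (res_map f x).
Proof. exact: (linearZ_LR f). Qed.

Lemma res_short_exact (X Y Z : lmodType S) (f : {linear X -> Y}) (g : {linear Y -> Z}) :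
  short_exact f g -> short_exact (res_map f) (res_map g).
Proof. by case=> fI fg gS; split. Qed.

End TrivextModules.

(** An action of $M$ is the balanced form of a structure map $\alpha : M
    \otimes X \to X$; [sqact_sq] is the condition $\alpha \circ (M \otimes
    \alpha) = 0$. *)
Record sqzero_action (R : pzRingType) (M : bimodType R) (X : lmodType R) := SqzeroAction {
  sqact : M -> X -> X;
  sqact_balanced : balanced sqact;
  sqactZ : forall r m x, sqact (r *: m) x = r *: sqact m x;
  sqact_sq : forall m m' x, sqact m (sqact m' x) = 0
}.

Section ActionModule.
Variables (R : pzRingType) (M : bimodType R) (X : lmodType R) (a : sqzero_action M X).
Local Notation S := (trivext M).

(** The vacuous binding makes the type depend on the action, so that two
    actions on the same $X$ carry distinct module structures. *)
Definition actmod : Type := let _ := a in X.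
HB.instance Definition _ := GRing.Zmodule.on actmod.

Definition actmod_scale (t : S) (x : actmod) : actmod :=
  (t.1 *: (x : X) + sqact a t.2 x : X).

Lemma sqactDl m m' x : sqact a (m + m') x = sqact a m x + sqact a m' x.
Proof. by case: (sqact_balanced a). Qed.
Lemma sqactDr m x x' : sqact a m (x + x') = sqact a m x + sqact a m x'.
Proof. by case: (sqact_balanced a). Qed.
Lemma sqactA m r x : sqact a (rscale m r) x = sqact a m (r *: x).
Proof. by case: (sqact_balanced a). Qed.
Lemma sqact0l x : sqact a 0 x = 0.
Proof. by apply: (addIr (sqact a 0 x)); rewrite -sqactDl !add0r. Qed.

Lemma actmod_scaleA s t x : actmod_scale s (actmod_scale t x) = actmod_scale (s * t) x.
Proof.
rewrite /actmod_scale /= scalerDr scalerA sqactDr sqact_sq addr0.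
by rewrite sqactDl sqactZ sqactA addrA.
Qed.
Lemma actmod_scale1 : left_id 1 actmod_scale.
Proof. by move=> x; rewrite /actmod_scale /= scale1r sqact0l addr0. Qed.
Lemma actmod_scaleDr : right_distributive actmod_scale +%R.
Proof. by move=> t x y; rewrite /actmod_scale scalerDr sqactDr addrACA. Qed.
Lemma actmod_scaleDl x : {morph actmod_scale^~ x : s t / s + t}.
Proof. by move=> s t; rewrite /actmod_scale /= scalerDl sqactDl addrACA. Qed.

HB.instance Definition _ := GRing.Zmodule_isLmodule.Build S actmod
  actmod_scaleA actmod_scale1 actmod_scaleDr actmod_scaleDl.

Lemma to_res_linear : linear (id : X -> res actmod).
Proof.
move=> r x y; congr (_ + y).
by rewrite /GRing.scale /= /res_scale /GRing.scale /= /actmod_scale /= sqact0l addr0.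
Qed.
Definition to_res : {linear X -> res actmod} := lin to_res_linear.

Lemma of_res_linear : linear (id : res actmod -> X).
Proof. by move=> r x y; exact: esym (to_res_linear r x y). Qed.
Definition of_res : {linear res actmod -> X} := lin of_res_linear.

Lemma mact_actmod m x : mact m (to_res x) = to_res (sqact a m x).
Proof.
by rewrite /mact /GRing.scale /= /actmod_scale /= scale0r add0r.
Qed.

Lemma class_to_res (C : modclass R) : closed_under_iso C -> C X -> C (res actmod).
Proof. by move=> Ciso; apply: (Ciso _ _ to_res); exists of_res. Qed.

Lemma class_of_res (C : modclass R) : closed_under_iso C -> C (res actmod) -> C X.
Proof. by move=> Ciso; apply: (Ciso _ _ of_res); exists to_res. Qed.

End ActionModule.

Lemma actmod_map (R : pzRingType) (M : bimodType R) (X Y : lmodType R)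
    (a : sqzero_action M X) (b : sqzero_action M Y) (f : {linear X -> Y}) :
  (forall m x, f (sqact a m x) = sqact b m (f x)) ->
  exists g : {linear actmod a -> actmod b}, forall x, g x = f x.
Proof.
move=> fab.
have [m x|g gE] := trivext_linear (f := to_res b \o (f \o of_res a) : {linear _ -> _}).
  have -> : mact m x = to_res a (sqact a m (of_res a x)) by exact: (mact_actmod a m x).
  by rewrite [RHS]mact_actmod /= fab.
by exists g.
Qed.

Section TrivialAction.
Variables (R : pzRingType) (M : bimodType R).

Lemma trivact_balanced (X : lmodType R) : balanced (fun (_ : M) (_ : X) => 0 : X).
Proof. by split=> *; rewrite ?addr0. Qed.
Lemma trivactZ (X : lmodType R) : forall (r : R) (_ : M) (_ : X), 0 = r *: 0 :> X.
Proof. by move=> *; rewrite scaler0. Qed.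

Definition trivact (X : lmodType R) : sqzero_action M X :=
  SqzeroAction (@trivact_balanced X) (@trivactZ X) (fun _ _ _ => erefl).

Definition triv (X : lmodType R) : lmodType (trivext M) := actmod (trivact X).

Lemma triv_map (X Y : lmodType R) (f : {linear X -> Y}) :
  exists g : {linear triv X -> triv Y}, forall x, g x = f x.
Proof. by apply: actmod_map => m x; rewrite linear0. Qed.

Lemma triv_ses (X Y Z : lmodType R) (f : {linear X -> Y}) (g : {linear Y -> Z}) :
  short_exact f g -> exists (f' : {linear triv X -> triv Y}) (g' : {linear triv Y -> triv Z}),
    short_exact f' g'.
Proof.
have [f' f'E] := triv_map f; have [g' g'E] := triv_map g.
case=> fI fg gS; exists f', g'; split=> [x y|b|z].
- by rewrite !f'E => /fI.
- rewrite g'E; split=> [/fg[a <-]|[a]]; first by exists a.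
  by rewrite f'E => <-; apply/fg; exists a.
- by have [y <-] := gS z; exists y; rewrite g'E.
Qed.

Lemma Uclass_triv (C : modclass R) X : closed_under_iso C -> C X -> Uclass M C (triv X).
Proof. exact: class_to_res. Qed.
Lemma Uclass_triv_inv (C : modclass R) X : closed_under_iso C -> Uclass M C (triv X) -> C X.
Proof. exact: class_of_res. Qed.

Lemma Uclass_summands (C : modclass R) : closed_under_iso C ->
  closed_under_summands (Uclass M C) -> closed_under_summands C.
Proof.
move=> Ciso Usum X A B f fB CX; apply: (Uclass_triv_inv Ciso).
have [g gE] := triv_map f.
have hl : linear (g : triv A * triv B -> triv X).
  move=> t [x y] [x' y'].
  have -> : t *: ((x, y) : triv A * triv B) + (x', y') =
      t *: ((x, y) : triv (A * B)%type) + (x', y').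
    by congr pair; rewrite /= /GRing.scale /= /actmod_scale /= !addr0.
  exact: linearP.
apply: (Usum (triv X) (triv A) (triv B) (lin hl)); last exact: Uclass_triv.
by apply: eq_bij fB _ _ => x; rewrite [RHS]gE.
Qed.

End TrivialAction.

(** * Coinduced modules and the descent of left pairs *)

Section HomFunctor.
Variables (R : pzRingType) (M : bimodType R).
Implicit Types A E L W Y : lmodType R.

Lemma hom_map_eq0 Y E (f : {linear Y -> E}) (u : homM M Y) :
  hom_map f u = 0 <-> forall m, f (hom_app u m) = 0.
Proof.
split=> [fu m|fu]; last by apply: hom_eqP => m; rewrite mk_homE fu.
by have := congr1 (fun h => hom_app h m) fu; rewrite mk_homE.
Qed.

Lemma hom_ses L E A (f : {linear L -> E}) (g : {linear E -> A}) :
  short_exact f g -> Ext_zero 1 (M : lmodType R) L ->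
  short_exact (hom_map f : {linear homM M L -> homM M E})
              (hom_map g : {linear homM M E -> homM M A}).
Proof.
move=> fg ext; have [fI fgE gS] := fg; split.
- move=> u v uv; apply: hom_eqP => m; apply: fI.
  by rewrite -!(mk_homE (hom_map_subproof f _)) [mk_hom _]uv.
- move=> u; split=> [gu|[v <-]]; last first.
    by apply: hom_eqP => m; rewrite !mk_homE (exact_comp0 _ fgE).
  have [|v vE] := factor_through_inj (w := hom_app u : {linear (M : lmodType R) -> E}) fI.
    by move=> m; apply/fgE; have := congr1 (fun h => hom_app h m) gu; rewrite mk_homE.
  by exists (mk_hom (linearP v)); apply: hom_eqP => m; rewrite !mk_homE vE.
- move=> u.
  have [v vE] := Ext_zero1_lift (hom_app u : {linear (M : lmodType R) -> A}) fg ext.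
  by exists (mk_hom (linearP v)); apply: hom_eqP => m; rewrite !mk_homE vE.
Qed.

Lemma hom_trivial Y : trivial_module Y -> trivial_module (homM M Y : lmodType R).
Proof. by move=> Y0 u; apply: hom_eqP => m; rewrite (Y0 (hom_app u m)). Qed.

(** $\mathrm{Ext}^1(M, L) = 0$ for every syzygy $L$ in the resolution, by
    dimension shifting, so $\mathrm{Hom}(M, -)$ keeps the resolution exact. *)
Lemma finite_res_hom n (D : modclass R) m W :
  (forall i Y, (1 <= i <= n)%N -> D Y -> Ext_zero i (M : lmodType R) Y) ->
  (forall Y, D Y -> D (homM M Y : lmodType R)) ->
  finite_res D m W -> (m <= n)%N -> finite_res D m (homM M W : lmodType R).
Proof.
move=> ext Dhom; elim=> {m W} [m W W0|m L Y W f g fg DY resL IH] mn.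
  exact/FiniteResTrivial/hom_trivial.
have extL : Ext_zero 1 (M : lmodType R) L.
  by apply: (Ext_zero_finite_res ext resL); exact: ltnW.
exact: (FiniteResCons (hom_ses fg extL) (Dhom _ DY) (IH (ltnW mn))).
Qed.

End HomFunctor.

Section CoinducedModule.
Variables (R : pzRingType) (M : bimodType R).
Implicit Types A C E K Y : lmodType R.

(** For $i$ the identity of $Y$ this gives the coinduced module
    $\mathrm{Hom}_R(R \ltimes M, Y)$; a general $i : Y \to E$ gives its
    pushout along $i$, where $Y$ sits inside it as $\mathrm{Ker}\,\beta$. *)
Definition homact_fun Y E (i : {linear Y -> E}) (m : M) (p : (E * homM M Y)%type) :
  (E * homM M Y)%type := (i (hom_app p.2 m), 0).

Lemma homact_balanced Y E (i : {linear Y -> E}) : balanced (homact_fun i).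
Proof.
split=> [m m' x|m x x'|m r x]; congr pair; rewrite /= ?addr0 //.
- by rewrite linearD linearD.
- by rewrite hom_addE linearD.
Qed.

Lemma homactZ Y E (i : {linear Y -> E}) r m p :
  homact_fun i (r *: m) p = r *: homact_fun i m p.
Proof. by congr pair; rewrite /= ?scaler0 // !linearZ. Qed.

Lemma homact_sq Y E (i : {linear Y -> E}) m m' p :
  homact_fun i m (homact_fun i m' p) = 0.
Proof. by congr pair; rewrite /= (linear0 i). Qed.

Definition homact Y E (i : {linear Y -> E}) : sqzero_action M (E * homM M Y)%type :=
  SqzeroAction (homact_balanced i) (homactZ i) (homact_sq i).

Definition homext Y E (i : {linear Y -> E}) : lmodType (trivext M) := actmod (homact i).

Definition coind Y := homext (idfun : {linear Y -> Y}).

Lemma homext_mact Y E (i : {linear Y -> E}) m e (u : homM M Y) :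
  mact m ((e, u) : res (homext i)) = ((i (hom_app u m), 0) : res (homext i)).
Proof. exact: (mact_actmod (homact i) m (e, u)). Qed.

Lemma homext_ses K E A (i : {linear K -> E}) (p : {linear E -> A}) :
  short_exact i p ->
  exists (f : {linear coind K -> homext i}) (g : {linear homext i -> triv M A}),
    [/\ short_exact f g, forall k u, f (k, u) = (i k, u) & forall e u, g (e, u) = p e].
Proof.
move=> [iI ip pS].
have fl : linear (fun x : (K * homM M K)%type => (i x.1, x.2) : (E * homM M K)%type).
  by move=> r x y; congr pair; rewrite /= linearP.
have gl : linear (fun x : (E * homM M K)%type => p x.1).
  by move=> r x y; rewrite /= linearP.
have [m x|f fE] := @actmod_map _ M _ _ (homact idfun) (homact i) (lin fl).
  by [].
have [m x|g gE] := @actmod_map _ M _ _ (homact i) (trivact M A) (lin gl).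
  by rewrite /= (exact_comp0 _ ip).
exists f, g; split=> [|k u|e u]; rewrite ?fE ?gE //; split.
- by move=> [k u] [k' u']; rewrite !fE /= => -[/iI -> ->].
- move=> [e u]; rewrite gE /=; split=> [/ip[k <-]|[[k v]]]; first by exists (k, u); rewrite fE.
  by rewrite fE /= => -[<- _]; apply/ip; exists k.
- by move=> a; have [e <-] := pS a; exists (e, 0); rewrite gE.
Qed.

Lemma beta_eq0 (X : lmodType (trivext M)) (x : res X) :
  beta X x = 0 <-> forall m, mact m x = 0.
Proof.
split=> [bx m|bx]; last by apply: hom_eqP => m; rewrite betaE bx.
by have := congr1 (fun h => hom_app h m) bx; rewrite betaE.
Qed.

Lemma coind_map K Y (u : {linear K -> Y}) :
  exists f : {linear coind K -> coind Y}, forall k v, f (k, v) = (u k, hom_map u v).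
Proof.
have fl : linear (fun x : (K * homM M K)%type => (u x.1, hom_map u x.2) : (Y * homM M Y)%type).
  by move=> r x y; congr pair; rewrite /= linearP.
have [m x|f fE] := @actmod_map _ M _ _ (homact idfun) (homact idfun) (lin fl).
  by congr pair; rewrite /= ?mk_homE ?(linear0 (hom_map u)).
by exists f => k v; rewrite fE.
Qed.

(** $\beta(y, u) = 0$ holds exactly when $u = 0$, so $\mathrm{Ker}\,\beta$ is
    $Y$; and a map $u : M \to \mathrm{Ker}\,\beta$ is $\beta(0, u)$. *)
Lemma Jclass_coind (D : modclass R) Y : closed_under_iso D -> D Y -> Jclass M D (coind Y).
Proof.
move=> Diso DY.
have b0 y (u : homM M Y) : beta (coind Y) (y, u) = 0 <-> u = 0.
  rewrite beta_eq0; split=> [u0|->] => [|m]; last by rewrite homext_mact.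
  apply: hom_eqP => m; have := congr1 fst (u0 m).
  by rewrite homext_mact.
split.
  have [|k kE] := factor_through_inj
    (w := to_res (homact idfun) \o prod_inl Y (homM M Y) : {linear _ -> _})
    (@kernel_incl_inj _ _ _ (beta (coind Y))).
    by move=> y; apply/kernel_inclP/b0.
  apply: (Diso _ _ k) => //; apply: inj_surj_bij => [y y' yy'|x].
    by have := congr1 (kernel_incl _) yy'; rewrite !kE => -[].
  case E : (kernel_incl (beta (coind Y)) x) => [y u].
  exists y; apply: kernel_incl_inj; rewrite kE E /=.
  by have := kernel_incl0 x; rewrite E => /b0 ->.
move=> u; split=> [/hom_map_eq0 u0|[x <-]]; last exact: beta_beta.
have vl : linear (fun m : (M : lmodType R) => (of_res (homact idfun) (hom_app u m)).1 : Y).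
  by move=> r x y; rewrite !linearP.
exists ((0, mk_hom vl) : res (coind Y)); apply: hom_eqP => m.
rewrite betaE homext_mact mk_homE /=.
case E : (hom_app u m) => [y v].
by have := u0 m; rewrite E => /b0 ->.
Qed.

(** The lifted extension of $Z(A)$ by the coinduced module of $K$, pushed to
    the coinduced module of $Y$, has a retraction; its first component, on the
    pairs $(e, 0)$, is the required extension of $u$. *)
Lemma Ext_zero1_descend_left (C D : modclass R) A Y :
  closed_under_iso C -> closed_under_iso D ->
  (forall X N, Uclass M C X -> Jclass M D N -> Ext_zero 1 X N) ->
  C A -> D Y -> Ext_zero 1 A Y.
Proof.
move=> Ciso Diso ext CA DY; apply/Ext_zero1P => K E i p ip u.
have [f [g [fg fE gE]]] := homext_ses ip.
have [u' u'E] := coind_map u.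
have /Ext_zero1P ext1 := ext _ _ (Uclass_triv M Ciso CA) (Jclass_coind Diso DY).
have [v vE] := ext1 _ _ _ _ fg u'.
have wl : linear (fun e : E => (v (e, 0)).1 : Y).
  have vl : linear (of_res (homact idfun) \o (res_map v \o (to_res (homact i) \o prod_inl _ _))) by exact: linearP.
  by move=> r x y; have := congr1 fst (vl r x y).
by exists (lin wl) => k /=; rewrite -fE vE u'E.
Qed.

End CoinducedModule.

Section JDescent.
Variables (R : pzRingType) (M : bimodType R).

Lemma res_map_beta (X Y : lmodType (trivext M)) (f : {linear X -> Y}) x :
  beta Y (res_map f x) = hom_map (res_map f) (beta X x).
Proof. by apply: hom_eqP => m; rewrite betaE [RHS]mk_homE betaE res_map_mact. Qed.

(** Surjectivity on the right is where the exactness condition on $L$ enters: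
    if $x \in X$ maps to $\mathrm{Ker}\,\beta_K$, then $\beta_X(x)$ takes
    values in $L$, so it is $\beta_L(l)$ for some $l$, and $x - l$ lies in
    $\mathrm{Ker}\,\beta_X$. *)
Lemma kernel_beta_ses (L X K : lmodType (trivext M)) (f : {linear L -> X}) (g : {linear X -> K}) :
  short_exact f g -> exact (beta L) (hom_map (beta L)) ->
  exists (f' : {linear kernel (beta L) -> kernel (beta X)})
         (g' : {linear kernel (beta X) -> kernel (beta K)}),
    short_exact f' g' /\ forall x, kernel_incl (beta K) (g' x) = res_map g (kernel_incl (beta X) x).
Proof.
move=> /res_short_exact[fI fg gS] Lex.
have [|f' f'E] := factor_through_inj (w := res_map f \o kernel_incl (beta L) : {linear _ -> _})
    (@kernel_incl_inj _ _ _ (beta X)).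
  by move=> x; apply/kernel_inclP; rewrite /= res_map_beta kernel_incl0 linear0.
have [|g' g'E] := factor_through_inj (w := res_map g \o kernel_incl (beta X) : {linear _ -> _})
    (@kernel_incl_inj _ _ _ (beta K)).
  by move=> x; apply/kernel_inclP; rewrite /= res_map_beta kernel_incl0 linear0.
exists f', g'; split=> //; split.
- move=> x y xy; apply: kernel_incl_inj; apply: fI.
  by have := congr1 (kernel_incl (beta X)) xy; rewrite !f'E.
- move=> x; split=> [gx|[y <-]]; last first.
    by apply: kernel_incl_inj; rewrite g'E -[LHS]/(res_map g (kernel_incl _ (f' y))) f'E linear0; exact: (exact_comp0 _ fg).
  have /fg[l lE] : res_map g (kernel_incl (beta X) x) = 0.
    by have := g'E x; rewrite gx linear0.
  have /kernel_inclP[l' l'E] : beta L l = 0.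
    apply/beta_eq0 => m; apply: fI; rewrite res_map_mact lE linear0.
    by move/beta_eq0: (kernel_incl0 x); exact.
  by exists l'; apply: kernel_incl_inj; rewrite f'E -lE -l'E.
- move=> z; have [x xE] := gS (kernel_incl (beta K) z).
  have [|b bE] := factor_through_inj (w := lin (beta_subproof x)) fI.
    move=> m; apply/fg; rewrite res_map_mact xE.
    by move/beta_eq0: (kernel_incl0 z); exact.
  have /Lex[l lE] : hom_map (beta L) (mk_hom (linearP b)) = 0.
    apply/hom_map_eq0 => m; rewrite mk_homE; apply/beta_eq0 => m'; apply: fI.
    by rewrite res_map_mact bE [LHS]mact_mact linear0.
  have /kernel_inclP[y yE] : beta X (x - res_map f l) = 0.
    apply/beta_eq0 => m; rewrite mactBr -res_map_mact -betaE -(betaE l).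
    by rewrite lE mk_homE bE subrr.
  exists y; apply: kernel_incl_inj.
  by rewrite g'E -[LHS]/(res_map g (kernel_incl _ y)) yE linearB (exact_comp0 _ fg) subr0 xE.
Qed.

(** A map $M \to \mathrm{Ker}\,\beta_K$ lifts to $\mathrm{Ker}\,\beta_X$,
    where it comes from an element of $X$. *)
Lemma beta_exact_quotient (L X K : lmodType (trivext M)) (f : {linear L -> X}) (g : {linear X -> K}) :
  short_exact f g -> exact (beta L) (hom_map (beta L)) -> exact (beta X) (hom_map (beta X)) ->
  Ext_zero 1 (M : lmodType R) (kernel (beta L)) ->
  exact (beta K) (hom_map (beta K)).
Proof.
move=> fg Lex Xex ext u; split=> [/hom_map_eq0 u0|[x <-]]; last exact: beta_beta.
have [f' [g' [fg' g'E]]] := kernel_beta_ses fg Lex.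
have [|u' u'E] := factor_through_inj (w := hom_app u : {linear (M : lmodType R) -> _})
    (@kernel_incl_inj _ _ _ (beta K)).
  by move=> m; apply/kernel_inclP; exact: u0.
have [v vE] := Ext_zero1_lift u' fg' ext.
have wl : linear (fun m : M => kernel_incl (beta X) (v m)) by move=> s x y; rewrite !linearP.
have /Xex[x xE] : hom_map (beta X) (mk_hom wl) = 0.
  by apply/hom_map_eq0 => m; rewrite mk_homE kernel_incl0.
exists (res_map g x); apply: hom_eqP => m.
by rewrite res_map_beta mk_homE xE mk_homE -g'E vE u'E.
Qed.

Lemma finite_res_Jclass n (D : modclass R) m (K : lmodType (trivext M)) :
  (forall i Y, (1 <= i <= n)%N -> D Y -> Ext_zero i (M : lmodType R) Y) ->
  finite_res (Jclass M D) m K -> (m <= n)%N ->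
  finite_res D m (kernel (beta K)) /\ exact (beta K) (hom_map (beta K)).
Proof.
move=> ext; elim=> {m K} [m K K0|m L X K f g fg [DX Xex] _ IH] mn.
  split; first by apply: FiniteResTrivial => k; apply: kernel_incl_inj; rewrite linear0; exact: K0.
  move=> u; split=> [_|[x <-]]; last exact: beta_beta.
  by exists 0; apply: hom_eqP => m'; rewrite (K0 (hom_app u m')); exact: K0.
have [resL Lex] := IH (ltnW mn).
have [f' [g' [fg' _]]] := kernel_beta_ses fg Lex.
split; first exact: FiniteResCons fg' DX resL.
apply: (beta_exact_quotient fg) => //.
by apply: (Ext_zero_finite_res ext resL); exact: ltnW.
Qed.

(** Under the exactness condition the image of $\beta_K$ is the kernel of
    $\mathrm{Hom}(M, \beta_K)$, that is $\mathrm{Hom}(M,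
    \mathrm{Ker}\,\beta_K)$ by left exactness. *)
Lemma beta_ses (K : lmodType (trivext M)) : exact (beta K) (hom_map (beta K)) ->
  exists p : {linear res K -> homM M (kernel (beta K))},
    short_exact (kernel_incl (beta K)) p.
Proof.
move=> Kex.
have kI := @kernel_incl_inj _ _ _ (beta K).
have homI : injective (hom_map (kernel_incl (beta K)) : {linear homM M (kernel (beta K)) -> homM M (res K)}).
  by apply: inj_ker0 => u /hom_map_eq0 u0; apply: hom_eqP => m; apply: kI; rewrite u0 linear0.
have inE (u : homM M (res K)) : hom_map (beta K) u = 0 <-> exists v, hom_map (kernel_incl (beta K)) v = u.
  split=> [/hom_map_eq0 u0|[v <-]]; last first.
    by apply/hom_map_eq0 => m; rewrite mk_homE kernel_incl0.
  have [|v vE] := factor_through_inj (w := hom_app u : {linear (M : lmodType R) -> _}) kI.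
    by move=> m; apply/kernel_inclP; exact: u0.
  by exists (mk_hom (linearP v)); apply: hom_eqP => m; rewrite !mk_homE vE.
have [|p pE] := factor_through_inj (w := beta K) homI.
  by move=> x; apply/inE; exact: beta_beta.
exists p; split=> //.
- move=> x; split=> [px|]; first by apply/kernel_inclP; rewrite -pE px linear0.
  by move/kernel_inclP => bx; apply: homI; rewrite pE bx linear0.
- move=> v; have /Kex[x xE] : hom_map (beta K) (hom_map (kernel_incl (beta K)) v) = 0.
    by apply/inE; exists v.
  by exists x; apply: homI; rewrite pE.
Qed.

Lemma Jclass_trivial (D : modclass R) : (forall Z : lmodType R, trivial_module Z -> D Z) ->
  forall Z : lmodType (trivext M), trivial_module Z -> Jclass M D Z.
Proof.
move=> D0 Z Z0; split.
  by apply: D0 => k; apply: kernel_incl_inj; rewrite linear0; exact: Z0.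
move=> u; split=> [_|[x <-]]; last exact: beta_beta.
by exists 0; apply: hom_eqP => m'; rewrite (Z0 (hom_app u m')); exact: Z0.
Qed.

Theorem left_pair_descends (n : nat) (C D : modclass R) :
  (0 < n)%N -> is_class C -> is_class D ->
  left_cotorsion_pair n (Uclass M C) (Jclass M D) ->
  hereditary n (Uclass M C) (Jclass M D) ->
  (forall i Y, (1 <= i <= n)%N -> D Y -> Ext_zero i (M : lmodType R) Y) ->
  (forall Y, D Y -> D (homM M Y : lmodType R)) ->
  closed_under_extensions (wedge D n.-1) ->
  left_cotorsion_pair n C D /\ hereditary n C D.
Proof.
move=> n_gt0 [C0 Ciso] [D0 Diso] UJ her extM Dhom Dext.
have [Usum ext_UJ Ucov] := UJ.
have Csum : closed_under_summands C by exact: (@Uclass_summands _ M).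
have resE (K : lmodType R) : wedge D n.-1 K <-> finite_res D n K.
  by rewrite -{2}(prednK n_gt0); exact: wedgeP.
have Ccov (A : lmodType R) : exists (K X : lmodType R) (f : {linear K -> X}) (g : {linear X -> A}),
    [/\ short_exact f g, C X & wedge D n.-1 K].
  have [K [X [f [g [fg CX wK]]]]] := Ucov (triv M A).
  exists (res K), (res X), (res_map f), (of_res (trivact M A) \o res_map g : {linear _ -> _}).
  split=> //.
  move: wK => /(wedgeP (Jclass_trivial D0)); rewrite prednK // => resK.
  have [resk Kex] := finite_res_Jclass extM resK (leqnn n).
  have [p ip] := beta_ses Kex.
  apply: (Dext _ _ _ _ _ ip); apply/resE => //.
  exact: (finite_res_hom extM).
(* The approximation of a projective module splits. *)
have projC P : projective P -> C P.
  move=> pP; have [K [X [f [g [fg CX _]]]]] := Ccov P.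
  have [s sE] := projective_split pP fg.
  by have [h hB] := short_exact_split fg sE; exact: Csum hB CX.
have kerC (K X A : lmodType R) (f : {linear K -> X}) (g : {linear X -> A}) :
    short_exact f g -> C X -> C A -> C K.
  move=> fg CX CA; have [f' [g' fg']] := triv_ses M fg.
  apply: (Uclass_triv_inv (M := M) Ciso).
  by apply: (left_closed_kernels n_gt0 (Jclass_trivial D0) UJ her fg'); exact: Uclass_triv.
have extCD i (X Y : lmodType R) : C X -> D Y -> Ext_zero i.+1 X Y.
  elim: i X => [|i IH] X CX DY.
    apply: (Ext_zero1_descend_left (M := M) Ciso Diso) CX DY => U N CU DN.
    by apply: ext_UJ => //; rewrite n_gt0.
  apply/Ext_zeroSSP => K P k p pP kp; apply: IH => //.
  by apply: (kerC _ _ _ _ _ kp) => //; exact: projC.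
split; last by move=> X Y; exact: extCD.
by split=> // -[|i] X Y // _; exact: extCD.
Qed.

End JDescent.

(** * Tensor products and vanishing of Tor *)

Section TensorFunctor.
Variables (R : pzRingType) (M : bimodType R).
Implicit Types A B C E K L P Q W X Y Z : lmodType R.

Lemma tens0r X (m : M) : tens m (0 : X) = 0.
Proof. by apply: (addIr (tens m (0 : X))); rewrite -tensDr !add0r. Qed.

Lemma tensNr X (m : M) (x : X) : tens m (- x) = - tens m x.
Proof. by apply/eqP; rewrite -addr_eq0 -tensDr addNr tens0r. Qed.

Lemma tensBr X (m : M) (x y : X) : tens m (x - y) = tens m x - tens m y.
Proof. by rewrite tensDr tensNr. Qed.

Lemma tensor_linear_ext X Y (f g : {linear tensor M X -> Y}) :
  (forall m x, f (tens m x) = g (tens m x)) -> f =1 g.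
Proof.
move=> fg; apply: tensor_ind => [//|t t' ft ft'].
by rewrite (linearB f) (linearB g) ft ft'.
Qed.

Lemma tensor_map_comp X Y Z (f : {linear X -> Y}) (g : {linear Y -> Z}) (h : {linear X -> Z}) t :
  (forall x, h x = g (f x)) -> tensor_map M h t = tensor_map M g (tensor_map M f t).
Proof.
move=> hE; apply: (@tensor_linear_ext _ _ (tensor_map M h) (tensor_map M g \o tensor_map M f)).
by move=> m x; rewrite /= !tensor_mapE hE.
Qed.

Lemma tensor_map_id X (f : {linear X -> X}) t : (forall x, f x = x) -> tensor_map M f t = t.
Proof.
move=> fE; apply: (@tensor_linear_ext _ _ (tensor_map M f) idfun).
by move=> m x; rewrite /= tensor_mapE fE.
Qed.

Lemma tensor_map_eq0 X Y (f : {linear X -> Y}) t : (forall x, f x = 0) -> tensor_map M f t = 0.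
Proof.
move=> f0; elim/tensor_ind: t => [m x|t t' IH IH']; first by rewrite tensor_mapE f0 tens0r.
by rewrite linearB /= IH IH' subrr.
Qed.

Lemma tensor_map_surj X Y (g : {linear X -> Y}) : surjection g -> surjection (tensor_map M g).
Proof.
move=> gS; elim/tensor_ind => [m y|t t' [s <-] [s' <-]].
  by have [x <-] := gS y; exists (tens m x); rewrite tensor_mapE.
by exists (s - s'); rewrite (linearB (tensor_map M g)).
Qed.

(** A map from $M \otimes Z$ to the cokernel of $M \otimes f$, inverse to the
    one induced by $g$, is given by lifting the second factor along $g$; the
    choice of the lift does not matter modulo the image of $M \otimes f$. *)
Lemma tensor_right_exact X Y Z (f : {linear X -> Y}) (g : {linear Y -> Z}) :
  exact f g -> surjection g -> exact (tensor_map M f) (tensor_map M g).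
Proof.
move=> fg gS t.
have gf0 s : tensor_map M g (tensor_map M f s) = 0.
  rewrite -(tensor_map_comp (h := g \o f : {linear _ -> _})) //.
  by apply: tensor_map_eq0 => x; exact: (exact_comp0 _ fg).
split=> [gt|[s <-]]; last exact: gf0.
pose q : {linear tensor M Y -> cokernel (tensor_map M f)} := coker_proj (tensor_map M f).
have qE m y y' : g y = g y' -> q (tens m y) = q (tens m y').
  move=> gyy'; have /fg[x xE] : g (y - y') = 0 by rewrite linearB gyy' subrr.
  by apply/coker_projP; exists (tens m x); rewrite [LHS]tensor_mapE xE tensBr.
pose s z := projT1 (cid (gS z)).
have sE z : g (s z) = z by exact: projT2 (cid (gS z)).
pose phi m z := q (tens m (s z)).
have phiE m y : phi m (g y) = q (tens m y) by apply: qE; rewrite sE.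
have phib : balanced phi.
  split=> [m m' z|m z z'|m r z].
  - by rewrite /phi tensDl linearD.
  - by rewrite -(sE z) -(sE z') -linearD !phiE tensDr linearD.
  - by rewrite -(sE z) -linearZ !phiE tensA.
suff qt : q t = tensor_lift phi (tensor_map M g t).
  have lB := tensor_lift_additive phib.
  by apply/coker_proj0; rewrite [LHS]qt gt -(subrr 0) lB subrr.
elim/tensor_ind: t {gt} => [m y|t t' IH IH'].
  by rewrite tensor_mapE tensor_liftE // phiE.
by rewrite !linearB tensor_lift_additive // -IH -IH'.
Qed.

(** The definition of Tor gives injectivity of $M \otimes K_1 \to M \otimes
    P_0$ for a syzygy $K_1$ of $A$. For a general extension $E$ of $A$ by $K$,
    the sequence $K_1 \to K \times P_0 \to E \to 0$ reduces the claim to that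
    case. *)
Lemma Tor_zero1_inj K E A (f : {linear K -> E}) (g : {linear E -> A}) :
  short_exact f g -> Tor_zero 1 M A -> injective (tensor_map M f).
Proof.
move=> [fI fg gS] tor; have [P pP] := exists_projective_resolution A.
have [K1 [k kp]] : exists (K1 : lmodType R) (k : {linear K1 -> term P 0}), short_exact k (aug P).
  by exists (kernel (aug P)), (kernel_incl _); exact/kernel_ses/aug_surj.
have [kI kpE _] := kp; have [e eE] := truncate_aug kp.
have eS := truncate_surj kp eE.
have kT0 (t : tensor M K1) : tensor_map M k t = 0 -> t = 0.
  have [s <-] := tensor_map_surj eS t.
  rewrite -(tensor_map_comp (h := diff P 0)) => [/(tor P pP s)[r <-]|x]; last by rewrite eE.
  have /tensor_right_exact := truncate_exact0 kp eE => /(_ eS) ex.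
  by apply/ex; exists r.
have [h hE] := pP 0%N _ _ g (aug P) gS.
pose c := copair f h.
have cS : surjection c.
  move=> x; have [p pE] := aug_surj P (g x).
  have /fg[y yE] : g (x - h p) = 0 by rewrite linearB hE pE subrr.
  by exists (y, p); rewrite /c /= yE subrK.
have [|u uE] := factor_through_inj (w := h \o k : {linear _ -> _}) fI.
  by move=> z; apply/fg; rewrite hE (exact_comp0 _ kpE).
have al : linear (fun z => (- u z, k z) : (K * term P 0)%type).
  by move=> s x y; rewrite !linearP.
have ac : exact (lin al) c.
  move=> [y p]; split=> [|[z [<- <-]]]; last by rewrite /c /= linearN uE addNr.
  rewrite /c /= => yp.
  have /kpE[z zE] : aug P p = 0.
    by rewrite -hE -[RHS](linear0 g) -yp linearD (exact_comp0 _ fg) add0r.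
  exists z; congr pair => //; apply: fI; rewrite linearN uE /= zE; apply/eqP.
  by rewrite eq_sym -addr_eq0 yp.
have fl : linear (fun z : (K * term P 0)%type => z.1) by [].
have sl : linear (fun z : (K * term P 0)%type => z.2) by [].
apply: inj_ker0 => t ft.
have /(tensor_right_exact ac cS)[s sE] : tensor_map M c (tensor_map M (prod_inl K (term P 0)) t) = 0.
  rewrite -ft; apply/esym/tensor_map_comp => x.
  by rewrite /c /= linear0 addr0.
have s0 : s = 0.
  apply: kT0; rewrite (tensor_map_comp (f := lin al) (g := lin sl)) // sE.
  rewrite -(tensor_map_comp (h := (\0 : {linear _ -> _}))) //.
  exact: tensor_map_eq0.
rewrite -[t](tensor_map_id (f := idfun)) //.
rewrite (tensor_map_comp (f := prod_inl K (term P 0)) (g := lin fl)) //.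
by rewrite -sE s0 !linear0.
Qed.

Lemma Tor_zero1_proj A :
  (forall K P (f : {linear K -> P}) (g : {linear P -> A}), projective P ->
     short_exact f g -> injective (tensor_map M f)) -> Tor_zero 1 M A.
Proof.
move=> inj P pP.
have kp := kernel_ses (aug_surj P).
have [e eE] := truncate_aug kp.
have eS := truncate_surj kp eE.
have compE t : tensor_map M (diff P 0) t = tensor_map M (kernel_incl (aug P)) (tensor_map M e t).
  by apply: tensor_map_comp => x; rewrite eE.
move=> t; rewrite -(tensor_right_exact (truncate_exact0 kp eE) eS) compE.
split=> [|->]; last by rewrite linear0.
by apply: ker0_inj; exact: inj kp.
Qed.

Lemma Tor_zeroSSP i A : Tor_zero i.+2 M A <->
  forall K P (k : {linear K -> P}) (p : {linear P -> A}),
    projective P -> short_exact k p -> Tor_zero i.+1 M K.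
Proof.
split=> [tor K P k p pP kp Q pQ|tor P pP].
  exact: (tor (splice kp Q) (splice_projective pP pQ)).
have kp := kernel_ses (aug_surj P).
have [e eE] := truncate_aug kp.
exact: (tor _ _ _ _ (pP 0%N) kp (truncate kp eE) (truncate_projective pP)).
Qed.

Lemma Tor_zero_projective i P : projective P -> Tor_zero i.+1 M P.
Proof.
elim: i P => [|i IH] P pP.
  apply: Tor_zero1_proj => K Q k q _ kq; have [r rE] := projective_retract pP kq.
  apply: can_inj (tensor_map M r) _ => t.
  rewrite -(tensor_map_comp (h := idfun)) => [|x]; last by rewrite rE.
  exact: tensor_map_id.
apply/Tor_zeroSSP => K Q k q pQ kq; apply: IH; exact: projective_kernel kq.
Qed.

(** Same induction as for Ext: the horseshoe lowers the degree, and in degree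
    one the inclusion of syzygies $W_1 \to X_1 \to P_0 \times Q_0$ stays
    injective after tensoring. *)
Lemma Tor_zero_sub i W X L (f : {linear W -> X}) (g : {linear X -> L}) :
  short_exact f g -> Tor_zero i.+1 M X -> Tor_zero i.+2 M L -> Tor_zero i.+1 M W.
Proof.
have [L1 [Q0 [l1 [l0 [pQ0 l1l0]]]]] := exists_projective_cover L.
elim: i W X L f g L1 Q0 l1 l0 pQ0 l1l0 => [|i IH] W X L f g L1 Q0 l1 l0 pQ0 l1l0 fg torX /Tor_zeroSSP torL.
  apply: Tor_zero1_proj => W1 P0 w1 w0 pP0 w1w0.
  have [X1 [x1 [x0 [a [b [x1x0 ab abE]]]]]] := horseshoe fg w1w0 pQ0 l1l0.
  have aI := Tor_zero1_inj ab (torL _ _ _ _ pQ0 l1l0).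
  have x1I := Tor_zero1_inj x1x0 torX.
  move=> t t' tt'; apply: aI; apply: x1I.
  have E s : tensor_map M x1 (tensor_map M a s) = tensor_map M (prod_inl P0 Q0) (tensor_map M w1 s).
    by rewrite -!(tensor_map_comp (h := prod_inl P0 Q0 \o w1 : {linear _ -> _})).
  by rewrite !E tt'.
apply/Tor_zeroSSP => W1 P0 w1 w0 pP0 w1w0.
have [X1 [x1 [x0 [a [b [x1x0 ab _]]]]]] := horseshoe fg w1w0 pQ0 l1l0.
have [L2 [Q1 [l2 [l3 [pQ1 l2l3]]]]] := exists_projective_cover L1.
apply: (IH _ _ _ _ _ _ _ _ _ pQ1 l2l3 ab); last exact: torL pQ0 l1l0.
exact: (Tor_zeroSSP _ _).1 torX _ _ _ _ (projective_prod pP0 pQ0) x1x0.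
Qed.

Lemma tensor_ses W X L (f : {linear W -> X}) (g : {linear X -> L}) :
  short_exact f g -> Tor_zero 1 M L ->
  short_exact (tensor_map M f : {linear tensor M W -> tensor M X})
              (tensor_map M g : {linear tensor M X -> tensor M L}).
Proof.
move=> fgE tor; have [_ fg gS] := fgE; split.
- exact: Tor_zero1_inj fgE tor.
- exact: tensor_right_exact.
- exact: tensor_map_surj.
Qed.

Lemma tensor_trivial X : trivial_module X -> trivial_module (tensor M X : lmodType R).
Proof.
move=> X0; apply: tensor_ind => [m x|t t' -> ->]; last by rewrite subrr.
by rewrite (X0 x) tens0r.
Qed.

Section FiniteCoresolutions.
Variables (n : nat) (C : modclass R).
Hypothesis torC : forall i X, (1 <= i <= n)%N -> C X -> Tor_zero i M X.

Lemma Tor_zero_finite_cores m W i :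
  finite_cores C m W -> (i + m <= n)%N -> Tor_zero i.+1 M W.
Proof.
move=> resW; elim: resW i => {m W} [m W W0|m W X L f g fg CX _ IH] i im.
  exact/Tor_zero_projective/trivial_projective.
apply: (Tor_zero_sub fg); last by apply: IH; rewrite addSnnS.
by apply: torC => //=; apply: leq_trans im; rewrite addnS ltnS leq_addr.
Qed.

(** $\mathrm{Tor}_1(M, L) = 0$ for every cosyzygy $L$ in the coresolution, by
    dimension shifting, so $M \otimes -$ keeps the coresolution exact. *)
Lemma finite_cores_tensor m W :
  (forall X, C X -> C (tensor M X : lmodType R)) ->
  finite_cores C m W -> (m <= n)%N -> finite_cores C m (tensor M W : lmodType R).
Proof.
move=> CT; elim=> {m W} [m W W0|m W X L f g fg CX resL IH] mn.
  exact/FiniteCoresTrivial/tensor_trivial.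
have torL : Tor_zero 1 M L by apply: (Tor_zero_finite_cores resL); exact: ltnW.
exact: (FiniteCoresCons (tensor_ses fg torL) (CT _ CX) (IH (ltnW mn))).
Qed.

End FiniteCoresolutions.

End TensorFunctor.

(** * Induced modules and the descent of right pairs *)

Section InducedModule.
Variables (R : pzRingType) (M : bimodType R).
Implicit Types A C E K Y : lmodType R.

(** For $p$ the identity of $A$ this gives the induced module $(R \ltimes M)
    \otimes_R A$; a general $p : E \to A$ gives its pullback along $p$, where
    $A$ is the quotient $\mathrm{Coker}\,\alpha$. *)
Definition tensact_fun E A (p : {linear E -> A}) (m : M) (x : (E * tensor M A)%type) :
  (E * tensor M A)%type := (0, tens m (p x.1)).

Lemma tensact_balanced E A (p : {linear E -> A}) : balanced (tensact_fun p).
Proof.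
split=> [m m' x|m x x'|m r x]; congr pair; rewrite /= ?addr0 //.
- exact: tensDl.
- by rewrite linearD tensDr.
- by rewrite tensA linearZ.
Qed.

Lemma tensactZ E A (p : {linear E -> A}) r m x :
  tensact_fun p (r *: m) x = r *: tensact_fun p m x.
Proof. by congr pair; rewrite /= ?scaler0 // tensZl. Qed.

Lemma tensact_sq E A (p : {linear E -> A}) m m' x :
  tensact_fun p m (tensact_fun p m' x) = 0.
Proof. by congr pair; rewrite /= linear0 tens0r. Qed.

Definition tensact E A (p : {linear E -> A}) : sqzero_action M (E * tensor M A)%type :=
  SqzeroAction (tensact_balanced p) (tensactZ p) (tensact_sq p).

Definition tensext E A (p : {linear E -> A}) : lmodType (trivext M) := actmod (tensact p).

Definition ind A := tensext (idfun : {linear A -> A}).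

Lemma tensext_mact E A (p : {linear E -> A}) m e (t : tensor M A) :
  mact m ((e, t) : res (tensext p)) = ((0, tens m (p e)) : res (tensext p)).
Proof. exact: (mact_actmod (tensact p) m (e, t)). Qed.

Lemma tensext_ses K E A (i : {linear K -> E}) (p : {linear E -> A}) :
  short_exact i p ->
  exists (f : {linear triv M K -> tensext p}) (g : {linear tensext p -> ind A}),
    [/\ short_exact f g, forall k, f k = (i k, 0) & forall e t, g (e, t) = (p e, t)].
Proof.
move=> [iI ip pS].
have gl : linear (fun x : (E * tensor M A)%type => (p x.1, x.2) : (A * tensor M A)%type).
  by move=> r x y; congr pair; rewrite /= linearP.
have [m x|f fE] := @actmod_map _ M _ _ (trivact M K) (tensact p)
    (prod_inl E (tensor M A) \o i : {linear _ -> _}).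
  by rewrite linear0; congr pair; rewrite /= (exact_comp0 _ ip) tens0r.
have [m x|g gE] := @actmod_map _ M _ _ (tensact p) (tensact idfun) (lin gl).
  by congr pair; rewrite /= linear0.
exists f, g; split=> [|k|e t]; rewrite ?fE ?gE //; split.
- by move=> k k'; rewrite !fE /= => -[/iI].
- move=> [e t]; rewrite gE /=; split=> [[/ip[k <-] ->]|[k]]; first by exists k; rewrite fE.
  by rewrite fE /= => -[<- <-]; congr pair; apply/ip; exists k.
- by move=> [a t]; have [e <-] := pS a; exists (e, t); rewrite gE.
Qed.

End InducedModule.

Section BDescent.
Variables (R : pzRingType) (M : bimodType R).

Lemma res_map_alpha (X Y : lmodType (trivext M)) (f : {linear X -> Y}) t :
  alpha Y (tensor_map M (res_map f) t) = res_map f (alpha X t).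
Proof.
apply: (@tensor_linear_ext _ _ _ _ (alpha Y \o tensor_map M (res_map f)) (res_map f \o alpha X)).
by move=> m x; rewrite /= tensor_mapE !alphaE -res_map_mact.
Qed.

Definition cproj (X : lmodType (trivext M)) : {linear res X -> cokernel (alpha X)} :=
  coker_proj (alpha X).

Lemma cproj0 (X : lmodType (trivext M)) x : cproj X x = 0 <-> exists t, alpha X t = x.
Proof. exact: coker_proj0. Qed.

Lemma cproj_surj (X : lmodType (trivext M)) : surjection (cproj X).
Proof. exact: coker_proj_surj. Qed.

Lemma cokernel_map (X Y : lmodType (trivext M)) (f : {linear X -> Y}) :
  exists f' : {linear cokernel (alpha X) -> cokernel (alpha Y)},
    forall x, f' (cproj X x) = cproj Y (res_map f x).
Proof.
apply: (factor_through_surj (s := cproj X) (w := cproj Y \o res_map f : {linear _ -> _})).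
  exact: cproj_surj.
move=> x /cproj0[t <-]; apply/cproj0.
by exists (tensor_map M (res_map f) t); rewrite res_map_alpha.
Qed.

(** Injectivity on the left is where the exactness condition on $L$ enters: if
    $x \in K$ is $\alpha_X(t)$, the image of $t$ in $M \otimes L$ is killed by
    $\alpha_L$, so $t$ can be corrected by an element of the image of $M
    \otimes \alpha_X$, on which $\alpha_X$ vanishes, to come from $M \otimes
    K$. *)
Lemma cokernel_alpha_ses (K X L : lmodType (trivext M)) (f : {linear K -> X}) (g : {linear X -> L}) :
  short_exact f g -> exact (tensor_map M (alpha L)) (alpha L) ->
  exists (f' : {linear cokernel (alpha K) -> cokernel (alpha X)})
         (g' : {linear cokernel (alpha X) -> cokernel (alpha L)}),
    short_exact f' g' /\ forall x, f' (cproj K x) = cproj X (res_map f x).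
Proof.
move=> /res_short_exact[fI fg gS] Lex.
have [f' f'E] := cokernel_map f; have [g' g'E] := cokernel_map g.
exists f', g'; split=> //; split.
- apply: inj_ker0 => c; have [x <-] := cproj_surj c.
  rewrite f'E => /cproj0[t tx].
  have /Lex[s' s'E] : alpha L (tensor_map M (res_map g) t) = 0.
    by rewrite res_map_alpha tx (exact_comp0 _ fg).
  have [s sE] := tensor_map_surj (tensor_map_surj gS) s'.
  have /(tensor_right_exact fg gS)[u uE] :
      tensor_map M (res_map g) (t - tensor_map M (alpha X) s) = 0.
    rewrite linearB /= -s'E -sE; apply/eqP; rewrite subr_eq0; apply/eqP.
    rewrite -!(tensor_map_comp (h := res_map g \o alpha X : {linear _ -> _})) // => y.
    by rewrite /= res_map_alpha.
  apply/cproj0; exists u; apply: fI.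
  by rewrite -res_map_alpha uE linearB /= alpha_alpha subr0.
- move=> c; have [x <-] := cproj_surj c; rewrite g'E; split=> [/cproj0[t' tx]|[d]].
    have [t tE] := tensor_map_surj gS t'.
    have /fg[y yE] : res_map g (x - alpha X t) = 0.
      by rewrite linearB /= -res_map_alpha tE tx subrr.
    exists (cproj K y); rewrite f'E yE; apply/coker_projP.
    by exists (- t); rewrite linearN addrAC subrr add0r.
  have [y <-] := cproj_surj d; rewrite f'E => /coker_projP[t tE].
  apply/cproj0; exists (- tensor_map M (res_map g) t).
  by rewrite linearN /= res_map_alpha tE linearB (exact_comp0 _ fg) sub0r opprK.
- move=> c; have [z <-] := cproj_surj c; have [x <-] := gS z.
  by exists (cproj X x).
Qed.

(** By right exactness of the tensor product, the condition on $K$ says that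
    the kernel of $\alpha_K$ dies in $M \otimes \mathrm{Coker}\,\alpha_K$. It
    dies in $M \otimes \mathrm{Coker}\,\alpha_X$, which contains the former by
    the vanishing of $\mathrm{Tor}_1$. *)
Lemma alpha_exact_sub (K X L : lmodType (trivext M)) (f : {linear K -> X}) (g : {linear X -> L}) :
  short_exact f g -> exact (tensor_map M (alpha X)) (alpha X) ->
  exact (tensor_map M (alpha L)) (alpha L) ->
  Tor_zero 1 M (cokernel (alpha L)) ->
  exact (tensor_map M (alpha K)) (alpha K).
Proof.
move=> fg Xex Lex tor t; split=> [t0|[s <-]]; last exact: alpha_alpha.
have [f' [g' [fg' f'E]]] := cokernel_alpha_ses fg Lex.
have aex (Y : lmodType (trivext M)) : exact (alpha Y) (cproj Y) by move=> y; exact: cproj0.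
apply/(tensor_right_exact (@aex K) (@cproj_surj K)).
apply: (ker0_inj (Tor_zero1_inj fg' tor)).
transitivity (tensor_map M (cproj X) (tensor_map M (res_map f) t)).
  rewrite -[LHS](tensor_map_comp (h := f' \o cproj K : {linear _ -> _})) //.
  by apply: tensor_map_comp => x; exact: f'E.
apply/(tensor_right_exact (@aex X) (@cproj_surj X))/Xex.
by rewrite res_map_alpha t0 linear0.
Qed.

Lemma finite_cores_Bclass n (C : modclass R) m (K : lmodType (trivext M)) :
  (forall i X, (1 <= i <= n)%N -> C X -> Tor_zero i M X) ->
  finite_cores (Bclass M C) m K -> (m <= n)%N ->
  finite_cores C m (cokernel (alpha K)) /\ exact (tensor_map M (alpha K)) (alpha K).
Proof.
move=> tor; elim=> {m K} [m K K0|m K X L f g fg [CX Xex] _ IH] mn.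
  split.
    apply: FiniteCoresTrivial => c; have [x <-] := coker_proj_surj c.
    by apply/coker_proj0; exists 0; rewrite linear0 [RHS]K0.
  move=> t; have -> : t = 0 by exact: (tensor_trivial (X := res K) K0).
  by split=> _; [exists 0|]; rewrite linear0.
have [resL Lex] := IH (ltnW mn).
have [f' [g' [fg' _]]] := cokernel_alpha_ses fg Lex.
split; first exact: FiniteCoresCons fg' CX resL.
apply: (alpha_exact_sub fg) => //.
by apply: (Tor_zero_finite_cores tor resL); exact: ltnW.
Qed.

(** Under the exactness condition the image of $\alpha_K$ is the cokernel of
    $M \otimes \alpha_K$, that is $M \otimes \mathrm{Coker}\,\alpha_K$ by
    right exactness. *)
Lemma alpha_ses (K : lmodType (trivext M)) : exact (tensor_map M (alpha K)) (alpha K) ->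
  exists i : {linear tensor M (cokernel (alpha K)) -> res K}, short_exact i (cproj K).
Proof.
move=> Kex.
have aex : exact (alpha K) (cproj K) by move=> y; exact: cproj0.
have cS := tensor_map_surj (M := M) (@cproj_surj K).
have tex := tensor_right_exact (M := M) aex (@cproj_surj K).
have [|i iE] := factor_through_surj (s := tensor_map M (cproj K)) (w := alpha K) cS.
  by move=> t /tex[s <-]; exact: alpha_alpha.
exists i; split; last exact: cproj_surj.
- apply: inj_ker0 => y; have [t <-] := cS y.
  by rewrite iE => /Kex/tex.
- move=> x; rewrite cproj0; split=> [[t <-]|[y <-]].
    by exists (tensor_map M (cproj K) t); rewrite iE.
  by have [t <-] := cS y; exists t; rewrite iE.
Qed.

Lemma Bclass_trivial (C : modclass R) : (forall Z : lmodType R, trivial_module Z -> C Z) ->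
  forall Z : lmodType (trivext M), trivial_module Z -> Bclass M C Z.
Proof.
move=> C0 Z Z0; split.
  apply: C0 => c; have [x <-] := coker_proj_surj c.
  by apply/coker_proj0; exists 0; rewrite linear0 [RHS]Z0.
move=> t; have -> : t = 0 by exact: (tensor_trivial (X := res Z) Z0).
by split=> _; [exists 0|]; rewrite linear0.
Qed.

(** The map $\alpha$ is the projection to $M \otimes A$ followed by the
    inclusion of the second factor, so its cokernel is $A$; its kernel is $M
    \otimes (M \otimes A)$, which $M \otimes \alpha$ reaches. *)
Lemma Bclass_ind (C : modclass R) A : closed_under_iso C -> C A -> Bclass M C (ind M A).
Proof.
move=> Ciso CA.
have pl : linear (fun x : (A * tensor M A)%type => x.1) by [].
pose p : {linear res (ind M A) -> A} := lin pl \o of_res (tensact M idfun).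
pose j1 : {linear A -> res (ind M A)} := to_res (tensact M idfun) \o prod_inl _ _.
pose j2 : {linear tensor M A -> res (ind M A)} := to_res (tensact M idfun) \o prod_inr _ _.
have alE t : alpha (ind M A) t = j2 (tensor_map M p t).
  apply: (@tensor_linear_ext _ _ _ _ (alpha (ind M A)) (j2 \o tensor_map M p)).
  by move=> m [a s]; rewrite alphaE tensext_mact /= tensor_mapE.
have pj1 a : p (j1 a) = a by [].
have j2E t : j2 t = alpha (ind M A) (tensor_map M j1 t).
  rewrite alE -(tensor_map_comp (h := idfun)) //.
  by rewrite (tensor_map_id (f := idfun)).
split.
  apply: (Ciso _ _ (cproj (ind M A) \o j1 : {linear _ -> _})) => //.
  apply: inj_surj_bij.
    apply: inj_ker0 => a /cproj0[t]; rewrite alE => /(congr1 p).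
    by rewrite pj1 => <-.
  move=> c; have [[a s] <-] := cproj_surj c; exists a.
  apply/coker_projP; exists (- tensor_map M j1 s); rewrite linearN -j2E.
  by rewrite -[LHS]/(- (0 : A), - s) -[RHS]/(a - a, 0 - s) oppr0 subrr sub0r.
move=> t; split=> [|[s <-]]; last exact: alpha_alpha.
rewrite alE => /(congr1 (fun x => (of_res (tensact M idfun) x).2)) /= pt.
have pj2 : exact j2 p.
  by move=> [a s]; split=> [/= a0|[s' <-]] //; exists s; rewrite -a0.
have pS : surjection p by move=> a; exists (j1 a).
have /(tensor_right_exact pj2 pS)[s <-] := pt.
exists (tensor_map M (tensor_map M j1) s).
by apply/esym/tensor_map_comp => x; exact: j2E.
Qed.

(** The lifted extension of the induced module of $A$ by $Z(K)$, pushed to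
    $Z(Y)$, has a retraction; its restriction to the pairs $(e, 0)$ is the
    required extension of $u$. *)
Lemma Ext_zero1_descend_right (C D : modclass R) A Y :
  closed_under_iso C -> closed_under_iso D ->
  (forall X N, Bclass M C X -> Uclass M D N -> Ext_zero 1 X N) ->
  C A -> D Y -> Ext_zero 1 A Y.
Proof.
move=> Ciso Diso ext CA DY; apply/Ext_zero1P => K E i p ip u.
have [f [g [fg fE gE]]] := tensext_ses M ip.
have [u' u'E] := triv_map M u.
have /Ext_zero1P ext1 := ext _ _ (Bclass_ind Ciso CA) (Uclass_triv M Diso DY).
have [v vE] := ext1 _ _ _ _ fg u'.
exists (of_res (trivact M Y) \o (res_map v \o (to_res (tensact M p) \o prod_inl _ _)) : {linear _ -> _}).
by move=> k; have := vE k; rewrite fE u'E.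
Qed.

Theorem right_pair_descends (n : nat) (C D : modclass R) :
  (0 < n)%N -> is_class C -> is_class D ->
  right_cotorsion_pair n (Bclass M C) (Uclass M D) ->
  hereditary n (Bclass M C) (Uclass M D) ->
  (forall i X, (1 <= i <= n)%N -> C X -> Tor_zero i M X) ->
  (forall X, C X -> C (tensor M X : lmodType R)) ->
  closed_under_extensions (vee C n.-1) ->
  right_cotorsion_pair n C D /\ hereditary n C D.
Proof.
move=> n_gt0 [C0 Ciso] [D0 Diso] BU her torC Ctens Cext.
have [Usum ext_BU Ucov] := BU.
have Dsum : closed_under_summands D by exact: (@Uclass_summands _ M).
have coresE (K : lmodType R) : vee C n.-1 K <-> finite_cores C n K.
  by rewrite -{2}(prednK n_gt0); exact: veeP.
have Dcov (A : lmodType R) : exists (Y K : lmodType R) (f : {linear A -> Y}) (g : {linear Y -> K}),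
    [/\ short_exact f g, D Y & vee C n.-1 K].
  have [Y [K [f [g [fg DY wK]]]]] := Ucov (triv M A).
  exists (res Y), (res K), (res_map f \o to_res (trivact M A) : {linear _ -> _}), (res_map g).
  split=> //.
  move: wK => /(veeP (Bclass_trivial C0)); rewrite prednK // => coresK.
  have [coresc Kex] := finite_cores_Bclass torC coresK (leqnn n).
  have [i ip] := alpha_ses Kex.
  apply: (Cext _ _ _ _ _ ip); apply/coresE => //.
  exact: (finite_cores_tensor torC).
have cokD (A Y L : lmodType R) (f : {linear A -> Y}) (g : {linear Y -> L}) :
    short_exact f g -> D A -> D Y -> D L.
  move=> fg DA DY; have [f' [g' fg']] := triv_ses M fg.
  apply: (Uclass_triv_inv (M := M) Diso).
  by apply: (right_closed_cokernels n_gt0 (Bclass_trivial C0) BU her fg'); exact: Uclass_triv.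
have extCD i (X Y : lmodType R) : C X -> D Y -> Ext_zero i.+1 X Y.
  elim: i Y => [|i IH] Y CX DY.
    apply: (Ext_zero1_descend_right Ciso Diso) CX DY => B N BB DN.
    by apply: ext_BU => //; rewrite n_gt0.
  apply: Ext_zeroSS_embed => E u uI.
  have [Y' [K [v [g [[vI _ _] DY' _]]]]] := Dcov E.
  have vuI : injective (v \o u : {linear Y -> Y'}) by exact: inj_comp.
  have vu := cokernel_ses vuI.
  exists Y', (cokernel (v \o u : {linear Y -> Y'})), v, (coker_proj _).
  split=> //; apply: IH => //; exact: cokD vu DY DY'.
split; last by move=> X Y; exact: extCD.
by split=> // -[|i] X Y // _; exact: extCD.
Qed.

End BDescent.

(** * Descent of cotorsion pairs from the trivial extension *)

Theorem proposition4p10 (R : pzRingType) (M : bimodType R) (n : nat)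
    (hn : (1 <= n)%N) (C D : modclass R) (hC : is_class C) (hD : is_class D) :
  (left_cotorsion_pair n (Uclass M C) (Jclass M D) ->
   hereditary n (Uclass M C) (Jclass M D) ->
   (forall (i : nat) (Y : lmodType R), (1 <= i <= n)%N -> D Y ->
      Ext_zero i (M : lmodType R) Y) ->
   (forall Y : lmodType R, D Y ->
      Ext_zero 1 (homM M Y : lmodType R) Y) ->
   (forall Y : lmodType R, D Y -> D (homM M Y : lmodType R)) ->
   closed_under_extensions (wedge D n.-1) ->
   left_cotorsion_pair n C D /\ hereditary n C D)
  /\
  (right_cotorsion_pair n (Bclass M C) (Uclass M D) ->
   hereditary n (Bclass M C) (Uclass M D) ->
   (forall (i : nat) (X : lmodType R), (1 <= i <= n)%N -> C X ->
      Tor_zero i M X) ->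
   (forall X : lmodType R, C X ->
      Ext_zero 1 X (tensor M X : lmodType R)) ->
   (forall X : lmodType R, C X -> C (tensor M X : lmodType R)) ->
   closed_under_extensions (vee C n.-1) ->
   right_cotorsion_pair n C D /\ hereditary n C D).
Proof.
split=> [UJ her extM _ Dhom Dext|BU her torC _ Ctens Cext].
  exact: (left_pair_descends hn hC hD UJ her extM Dhom Dext).
exact: (right_pair_descends hn hC hD BU her torC Ctens Cext).
Qed.
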